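(* Let $c:[0,L]\to\mathbb{R}^3$ be a curve of class $C^2$ parameterized by arc-length, so that $L=\mathcal{L}(c)$, let $C:=\mathrm{TC}(c)$, and let $\mathfrak{t}_c:[0,C]\to\mathbb{S}^2$ be the weak tangent indicatrix of $c$. Then for each $s\in\,]0,L[$ there exists $k(s)\in[0,C]$ such that the tangent indicatrix $\mathfrak{t}:=\dot c$ satisfies $$\mathfrak{t}(s)=\mathfrak{t}_c(k(s)).$$ Moreover, $k(s)$ is equal to the total curvature $\mathrm{TC}(c_{|[0,s]})$ of the curve $c_{|[0,s]}:[0,s]\to\mathbb{R}^3$, whence $$k(s)=\int_0^s\mathbf{k}(\lambda)\,d\lambda\qquad\forall\,s\in[0,L],$$ where $\mathbf{k}(\lambda):=\|\ddot c(\lambda)\|$ is the curvature of $c$ at the point $c(\lambda)$.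
   Context: $\mathbb{S}^2\subset\mathbb{R}^3$ is the unit sphere with geodesic distance $d_{\mathbb{S}^2}$. A polygonal $P$ in $\mathbb{R}^3$ has consecutive vertices $v_0,\dots,v_n$ and oriented segments $\sigma_i=[v_{i-1},v_i]$, identified with $v_i-v_{i-1}$, all of positive length (repeated consecutive vertices are discarded). Put $t_i:=\sigma_i/\|\sigma_i\|\in\mathbb{S}^2$ and let $\gamma_i$ be a minimal oriented geodesic arc in $\mathbb{S}^2$ from $t_i$ to $t_{i+1}$, $i=1,\dots,n-1$. The total curvature is $\mathrm{TC}(P):=\sum_{i=1}^{n-1}d_{\mathbb{S}^2}(t_i,t_{i+1})$, and the tangent indicatrix $\mathfrak{t}_P:[0,\mathrm{TC}(P)]\to\mathbb{S}^2$ is the arc-length parameterization of the spherical polygonal obtained by joining $\gamma_1,\dots,\gamma_{n-1}$. Its constant-velocity parameterization on $[0,C]$ is $s\mapsto\mathfrak{t}_P(\mathrm{TC}(P)s/C)$. For closed polygonals ($v_0=v_n$) indices are cyclic. $P$ is inscribed in $c:[a,b]\to\mathbb{R}^3$ ($P\ll c$) if there is a partition $a=\lambda_0<\dots<\lambda_n=b$ such that $P$ has vertices $v_i=c(\lambda_i)$; $\operatorname{mesh}P:=\max_i\|v_i-v_{i-1}\|$; $\mathrm{TC}(c):=\sup\{\mathrm{TC}(P):P\ll c\}$ (and $\mathrm{TC}(c_{|[0,0]}):=0$). Weak tangent indicatrix. For a curve $c$ with finite total curvature $C=\mathrm{TC}(c)$ and no points of return (no $s\in\,]0,L[$ with $\dot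 c(s-)=-\dot c(s+)$ in the arc-length parameterization), there is a unique curve $\mathfrak{t}_c:[0,C]\to\mathbb{S}^2$, parameterized by arc-length, such that for every sequence $\{P_h\}$ of polygonals inscribed in $c$ with $\operatorname{mesh}P_h\to0$, the constant-velocity parameterizations on $[0,C]$ of $\mathfrak{t}_{P_h}$ converge to $\mathfrak{t}_c$ uniformly; $\mathfrak{t}_c$ is called here the weak tangent indicatrix of $c$.
   Formalization: The tangent indicatrix is tested only on inscribed polygonals whose partition mesh also tends to 0 (else undefined for non-injective c); restrictions of c to [0,s] count as arcs, and cyclic indices are used only if c closes up with its first two derivatives, since a corner breaks the formula. *)

(* Defs.v *)
From HB Require Import structures.
From mathcomp Require Import all_boot all_order all_algebra.
From mathcomp Require Import all_classical all_reals all_analysis.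

Set Implicit Arguments.
Unset Strict Implicit.
Unset Printing Implicit Defensive.

Import Order.TTheory GRing.Theory Num.Theory.
Import numFieldNormedType.Exports.

Local Open Scope classical_set_scope.
Local Open Scope ring_scope.

(* The library norm `|v| on 'rV[R]_3 is the sup norm, so the Euclidean one is
   defined here; both give the same topology. *)
Definition dot (R : realType) (u v : 'rV[R]_3) : R := \sum_(i < 3) u 0 i * v 0 i.

Definition enorm (R : realType) (v : 'rV[R]_3) : R := Num.sqrt (dot v v).

Definition sphere2 (R : realType) : set 'rV[R]_3 := [set x | enorm x = 1].

(* Geodesic distance; meaningful for x and y on the unit sphere. *)
Definition dS2 (R : realType) (x y : 'rV[R]_3) : R := acos (dot x y).

Section Polygonals.
Variable R : realType.
Implicit Type P : seq 'rV[R]_3.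

(* A polygonal is the sequence [:: v_0; ...; v_n] of its vertices. *)
Definition differences (V : zmodType) (s : seq V) : seq V :=
  if s is x :: s' then pairmap (fun u v => v - u) x s' else [::].

(* Discarding null differences amounts to discarding repeated consecutive
   vertices. *)
Definition segments P : seq 'rV[R]_3 := [seq w <- differences P | w != 0].

Definition mesh P : R := \big[Num.max/0]_(w <- segments P) enorm w.

(* The unit tangents t_1, ..., t_n.  With [cyc] set, the polygonal is regarded
   as closed and indices are cyclic: t_1 is appended at the end as t_{n+1}. *)
Definition tangents (cyc : bool) P : seq 'rV[R]_3 :=
  let t := [seq (enorm w)^-1 *: w | w <- segments P] in
  if cyc then t ++ take 1 t else t.

(* Spherical length of the polygonal joining the first i+1 points of t
   (with 0-based indexing, from t`_0 to t`_i). *)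
Definition cumulative (t : seq 'rV[R]_3) (i : nat) : R :=
  \sum_(0 <= j < i) dS2 t`_j t`_j.+1.

Definition TCpoly (cyc : bool) P : R :=
  let t := tangents cyc P in cumulative t (size t).-1.

(* A minimal geodesic arc with unit speed is an isometric embedding of an
   interval.  Such an arc is not unique between antipodal points, so being a
   tangent indicatrix of P is a relation.  The first clause only matters
   separately when there is a single tangent, hence no arc. *)
Definition tangent_indicatrix (cyc : bool) P (tau : R -> 'rV[R]_3) : Prop :=
  let t := tangents cyc P in
  (forall i, (i < size t)%N -> tau (cumulative t i) = t`_i) /\
  (forall i, (i.+1 < size t)%N ->
     forall u w, u \in `[cumulative t i, cumulative t i.+1] ->
                 w \in `[cumulative t i, cumulative t i.+1] ->
     sphere2 (tau u) /\ dS2 (tau u) (tau w) = `|u - w|).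

End Polygonals.

Section Curves.
Variable R : realType.
Implicit Types (c f : R -> 'rV[R]_3) (a b : R).

(* The inscribed polygonal with vertices c(a), c(l_1), ..., c(l_n), for a
   partition a < l_1 < ... < l_n = b, [itv_partition a b l]. *)
Definition inscribed c a (l : seq R) : seq 'rV[R]_3 := [seq c x | x <- a :: l].

Definition length_poly (P : seq 'rV[R]_3) : R := \sum_(w <- segments P) enorm w.

Definition curve_length c a b : \bar R :=
  ereal_sup [set (length_poly (inscribed c a l))%:E | l in itv_partition a b].

Definition arclength_param c a b : Prop :=
  forall u w, a <= u -> u <= w -> w <= b -> curve_length c u w = (w - u)%:E.

(* Total curvature of c restricted to [a, b]; it is 0 when a = b, the only
   partition being the empty one.  The flag [cyc] says whether the curve, hence
   each polygonal inscribed in it, is regarded as closed.  Closedness is not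
   read off from c(a) = c(b): a loop c|[0,s] of a longer curve is still an arc,
   with no angle counted at its base point. *)
Definition TC (cyc : bool) c a b : \bar R :=
  ereal_sup [set (TCpoly cyc (inscribed c a l))%:E | l in itv_partition a b].

Definition partition_mesh a (l : seq R) : R :=
  \big[Num.max/0]_(x <- differences (a :: l)) x.

(* Defining property of the weak tangent indicatrix tc : [0, C] -> S^2 of
   c : [0, L] -> R^3, where C = TC(c).  When c is injective,
   [partition_mesh] tends to 0 as soon as [mesh] does.  When c meets itself, or
   is closed, polygonals with small mesh may skip a whole loop of c, and no
   common limit exists unless such sequences are excluded. *)
Definition weak_tangent_indicatrix (cyc : bool) c (L : R) (tc : R -> 'rV[R]_3)
    : Prop :=
  let C := fine (TC cyc c 0 L) in
  [/\ forall s, s \in `[0, C] -> sphere2 (tc s),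
      arclength_param tc 0 C
    & forall (l : nat -> seq R) (tau : nat -> R -> 'rV[R]_3),
        (forall h, itv_partition 0 L (l h)) ->
        (forall h, tangent_indicatrix cyc (inscribed c 0 (l h)) (tau h)) ->
        mesh (inscribed c 0 (l h)) @[h --> \oo] --> (0 : R) ->
        partition_mesh 0 (l h) @[h --> \oo] --> (0 : R) ->
        {uniform `[0, C],
           (fun h s => tau h (TCpoly cyc (inscribed c 0 (l h)) * s / C))
             @ \oo --> tc}].

(* f' is the derivative of f on [a, b], one-sided at the endpoints. *)
Definition derivative_on a b f (f' : R -> 'rV[R]_3) : Prop :=
  forall s, s \in `[a, b] ->
    (u - s)^-1 *: (f u - f s) @[u --> within `[a, b] s^'] --> f' s.

(* c is of class C^2 on [a, b] with first and second derivatives c1 and c2. *)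
Definition class_C2 a b c (c1 c2 : R -> 'rV[R]_3) : Prop :=
  [/\ derivative_on a b c c1, derivative_on a b c1 c2
    & {within `[a, b], continuous c2}].

(* c is closed as a curve of class C^2. *)
Definition closes_up a b c (c1 c2 : R -> 'rV[R]_3) : Prop :=
  [/\ c a = c b, c1 a = c1 b & c2 a = c2 b].

End Curves.

(* Main.v *)
Require Import Defs.
From HB Require Import structures.
From mathcomp Require Import all_boot all_order all_algebra.
From mathcomp Require Import ring lra.
From mathcomp Require Import all_classical all_reals all_analysis.
Import Order.TTheory GRing.Theory Num.Theory.
Import numFieldNormedType.Exports.
Set Implicit Arguments.
Unset Strict Implicit.
Unset Printing Implicit Defensive.
Local Open Scope classical_set_scope.
Local Open Scope ring_scope.

(** Write [k s] for the integral of [|c2|] over [0, s], and [d] for the geodesic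
    distance of the sphere.  Everything rests on comparing the tangents of
    inscribed polygonals with the hodograph [c1], a curve on the sphere, as [c]
    has unit speed ([arclength_unit_speed]).

    Upper bound.  The chord of [c] over [a, b] is a limit of sums of vectors
    [c1 x], so its direction [T] lies in the spherical convex hull of the arc of
    hodograph, and replacing that arc by the detour through [T] does not
    lengthen it:
      [d (c1 a) T + d T (c1 b) <= k b - k a]  ([dS2_chord_le]).
    This follows by merging the vectors of the sum one at a time ([dS2_sum_le]),
    each merge being the additivity of [d] along a geodesic ([dS2_cone]).
    Concatenating these detours over the pieces of a partition and cutting the
    corners at the points [c1 x_i] bounds the total curvature of any inscribed
    polygonal, coarse or fine, by [k] ([TCpoly_le]).
    If the curve closes up, the corner at the base point is cut in the same way.

    Lower bound.  For the regular partition into [n] pieces, the [i]th tangent is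
    within [O(1 / n)] of [c1 x_i].  This error is too large to be summed over
    all pieces, but with [n = m ^ 2] it suffices to look at one tangent out of
    [m]: the errors then add up to [O(1 / m)], while the polygonal with vertices
    at the corresponding points of the hodograph has length tending to [k].
    Hence the length of the indicatrix up to a tangent close to [c1 s] tends to
    [k s], uniformly in [s] ([grid_indicatrix_approx]).  With the upper bound, it
    gives TC = [k] ([TC_eq_integral]).

    Weak indicatrix.  The same estimate says that the indicatrices [tau] of these
    polygonals reach a point close to [c1 s] at a parameter close to [k s].  As
    their total lengths tend to that of [tc], passing to constant velocity on
    the common interval moves this parameter by little; since [tau] tends to [tc]
    uniformly and [tc] is Lipschitz, [c1 s = tc (k s)]
    ([weak_indicatrix_at]). *)

(* The name [cumulative] also denotes cumulative distribution functions. *)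
Local Notation cumulative := Defs.cumulative.

(** * Euclidean inner product *)

Section Euclidean.
Variable R : realType.
Implicit Types u v w : 'rV[R]_3.

Lemma dotC u v : dot u v = dot v u.
Proof. by apply: eq_bigr => i _; rewrite mulrC. Qed.

Lemma dotDl u v w : dot (u + v) w = dot u w + dot v w.
Proof. by rewrite -big_split; apply: eq_bigr => i _; rewrite mxE mulrDl. Qed.

Lemma dotZl a u w : dot (a *: u) w = a * dot u w.
Proof. by rewrite mulr_sumr; apply: eq_bigr => i _; rewrite mxE mulrA. Qed.

Lemma dotNl u w : dot (- u) w = - dot u w.
Proof. by rewrite -scaleN1r dotZl mulN1r. Qed.

Lemma dotDr u v w : dot u (v + w) = dot u v + dot u w.
Proof. by rewrite dotC dotDl !(dotC u). Qed.

Lemma dotZr a u w : dot u (a *: w) = a * dot u w.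
Proof. by rewrite dotC dotZl dotC. Qed.

Lemma dotNr u w : dot u (- w) = - dot u w.
Proof. by rewrite dotC dotNl dotC. Qed.

Definition dotE := (dotDl, dotDr, dotNl, dotNr, dotZl, dotZr).

Lemma dot_ge0 u : 0 <= dot u u.
Proof. by apply: sumr_ge0 => i _; rewrite -expr2 sqr_ge0. Qed.

Lemma enorm_ge0 u : 0 <= enorm u.
Proof. exact: sqrtr_ge0. Qed.

Lemma sqr_enorm u : enorm u ^+ 2 = dot u u.
Proof. by rewrite sqr_sqrtr ?dot_ge0. Qed.

Lemma enormZ a u : enorm (a *: u) = `|a| * enorm u.
Proof. by rewrite /enorm !dotE mulrA -expr2 sqrtrM ?sqr_ge0// sqrtr_sqr. Qed.

Lemma enormN u : enorm (- u) = enorm u.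
Proof. by rewrite -scaleN1r enormZ normrN1 mul1r. Qed.

Lemma enormBC u v : enorm (u - v) = enorm (v - u).
Proof. by rewrite -opprB enormN. Qed.

Lemma enorm0 : enorm (0 : 'rV[R]_3) = 0.
Proof. by rewrite -(scale0r 0) enormZ normr0 mul0r. Qed.

Lemma coord_le_enorm u i : `|u 0 i| <= enorm u.
Proof.
rewrite -sqrtr_sqr ler_wsqrtr// /dot (bigD1 i)//= -expr2 lerDl.
by apply: sumr_ge0 => j _; rewrite -expr2 sqr_ge0.
Qed.

Lemma enorm_eq0 u : (enorm u == 0) = (u == 0).
Proof.
apply/eqP/eqP => [u0|->]; last exact: enorm0.
apply/matrixP => i j; rewrite ord1 mxE; apply/eqP.
by rewrite -normr_le0 -u0 coord_le_enorm.
Qed.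

Lemma enorm_gt0 u : (0 < enorm u) = (u != 0).
Proof. by rewrite lt_def enorm_ge0 andbT enorm_eq0. Qed.

(** Lagrange's identity: the defect in the Cauchy-Schwarz inequality is the
    squared norm of the cross product. *)
Lemma dot_le_enorm u v : dot u v <= enorm u * enorm v.
Proof.
have [uv0|uv0] := leP (dot u v) 0.
  by rewrite (le_trans uv0)// mulr_ge0 ?enorm_ge0.
rewrite -(@ler_pXn2r _ 2%N)// ?nnegrE ?mulr_ge0 ?enorm_ge0 ?(ltW uv0)//.
rewrite exprMn !sqr_enorm -subr_ge0 /dot !big_ord_recl !big_ord0.
set u0 := u _ _; set u1 := u _ _; set u2 := u _ _.
set v0 := v _ _; set v1 := v _ _; set v2 := v _ _.
rewrite [leRHS](_ : _ = (u0 * v1 - u1 * v0) ^+ 2 + (u1 * v2 - u2 * v1) ^+ 2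
  + (u2 * v0 - u0 * v2) ^+ 2); last by ring.
by rewrite !addr_ge0 ?sqr_ge0.
Qed.

Lemma normr_dot_le u v : `|dot u v| <= enorm u * enorm v.
Proof. by rewrite ler_norml lerNl -dotNl -{1}(enormN u) !dot_le_enorm. Qed.

Lemma enormD u v : enorm (u + v) <= enorm u + enorm v.
Proof.
rewrite -(@ler_pXn2r _ 2%N)// ?nnegrE ?addr_ge0 ?enorm_ge0//.
rewrite sqrrD !sqr_enorm !dotE (dotC v u).
by have := dot_le_enorm u v; lra.
Qed.

Lemma enorm_dist w u v : enorm (u - v) <= enorm (u - w) + enorm (w - v).
Proof. by rewrite -{1}(subrKA w); exact: enormD. Qed.

Lemma enorm_dist_norm u v : `|enorm u - enorm v| <= enorm (u - v).
Proof.
rewrite ler_norml lerBlDr lerNl opprB lerBlDr.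
have := enormD (u - v) v; have := enormD (v - u) u.
by rewrite !subrK (enormBC v) => -> ->.
Qed.

Lemma enorm_sum (I : Type) (r : seq I) (F : I -> 'rV[R]_3) :
  enorm (\sum_(i <- r) F i) <= \sum_(i <- r) enorm (F i).
Proof.
elim/big_ind2: _ => [|u a v b ua vb|//]; first by rewrite enorm0.
by rewrite (le_trans (enormD _ _))// lerD.
Qed.

Lemma enorm_normalize u : u != 0 -> enorm ((enorm u)^-1 *: u) = 1.
Proof.
by move=> u0; rewrite enormZ normfV ger0_norm ?enorm_ge0// mulVf// enorm_eq0.
Qed.

End Euclidean.

(** * Geodesic distance on the sphere *)

Section SphericalDistance.
Variable R : realType.
Implicit Types p q x y z : 'rV[R]_3.

Lemma dot_unit x : enorm x = 1 -> dot x x = 1.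
Proof. by move=> x1; rewrite -sqr_enorm x1 expr1n. Qed.

Lemma dot_unit_itv x y : enorm x = 1 -> enorm y = 1 -> -1 <= dot x y <= 1.
Proof.
move=> x1 y1; rewrite -ler_norml (le_trans (normr_dot_le _ _))//.
by rewrite x1 y1 mulr1.
Qed.

Lemma cos_dS2 x y : enorm x = 1 -> enorm y = 1 -> cos (dS2 x y) = dot x y.
Proof. by move=> x1 y1; rewrite acosK// in_itv/= dot_unit_itv. Qed.

Lemma dS2_ge0 x y : enorm x = 1 -> enorm y = 1 -> 0 <= dS2 x y.
Proof. by move=> x1 y1; rewrite acos_ge0// dot_unit_itv. Qed.

Lemma dS2_le_pi x y : enorm x = 1 -> enorm y = 1 -> dS2 x y <= pi.
Proof. by move=> x1 y1; rewrite acos_lepi// dot_unit_itv. Qed.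

Lemma dS2_in x y : enorm x = 1 -> enorm y = 1 -> dS2 x y \in `[0, pi].
Proof. by move=> x1 y1; rewrite in_itv/= dS2_ge0// dS2_le_pi. Qed.

Lemma sin_dS2_ge0 x y : enorm x = 1 -> enorm y = 1 -> 0 <= sin (dS2 x y).
Proof. by move=> x1 y1; rewrite /dS2 sin_acos ?dot_unit_itv// sqrtr_ge0. Qed.

Lemma dS2C x y : dS2 x y = dS2 y x.
Proof. by rewrite /dS2 dotC. Qed.

Lemma dS2xx x : enorm x = 1 -> dS2 x x = 0.
Proof. by move=> x1; rewrite /dS2 dot_unit// acos1. Qed.

Lemma ler_cos : {in `[0, pi] &, {mono @cos R : a b /~ b <= a}}.
Proof. by move=> a b ai bi; rewrite !leNgt ltr_cos. Qed.

Lemma enorm_perp x y : enorm x = 1 -> enorm y = 1 ->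
  enorm (x - dot x y *: y) = sin (dS2 x y).
Proof.
move=> x1 y1; rewrite /dS2 sin_acos ?dot_unit_itv// /enorm; congr Num.sqrt.
by rewrite !dotE (dotC y x) !dot_unit//; ring.
Qed.

(** If the right-hand side is at most pi, compare cosines: by the addition
    formula, the claim is the Cauchy-Schwarz inequality for the components of
    [x] and [z] orthogonal to [y], of norms [sin (d x y)] and [sin (d z y)]. *)
Lemma dS2_triangle y x z : enorm x = 1 -> enorm y = 1 -> enorm z = 1 ->
  dS2 x z <= dS2 x y + dS2 y z.
Proof.
move=> x1 y1 z1.
have [|/ltW sum_pi] := leP pi (dS2 x y + dS2 y z).
  exact/le_trans/dS2_le_pi.
rewrite -ler_cos ?dS2_in//; last by rewrite in_itv/= sum_pi addr_ge0 ?dS2_ge0.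
rewrite cosD !cos_dS2// (dS2C y z) -!enorm_perp//.
have := dot_le_enorm (x - dot x y *: y) (- (z - dot z y *: y)).
by rewrite enormN !dotE (dotC y z) (dotC z y) dot_unit//; lra.
Qed.

(** A nonnegative combination of two unit vectors points to their geodesic, so
    its direction splits the distance additively.  Antipodal vectors may cancel;
    then any direction is admissible and [q] itself is chosen. *)
Lemma dS2_cone p q a b : enorm p = 1 -> enorm q = 1 -> 0 <= a -> 0 <= b ->
  exists x, enorm x = 1 /\
  exists r, [/\ 0 <= r, r *: x = a *: p + b *: q
              & dS2 p x + dS2 x q <= dS2 p q].
Proof.
move=> p1 q1 a0 b0; set w := a *: p + b *: q.
have [w0|w0] := eqVneq w 0.
  exists q; split=> //; exists 0; split; rewrite ?scale0r//.
  by rewrite dS2xx// addr0.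
set r := enorm w; have r0 : 0 < r by rewrite enorm_gt0.
set x := r^-1 *: w; have x1 : enorm x = 1 by exact: enorm_normalize.
exists x; split=> //; exists r.
split; rewrite ?(ltW r0)// ?scalerA ?divff ?gt_eqF ?scale1r//.
have rsq : r ^+ 2 = a ^+ 2 + b ^+ 2 + 2 * a * b * dot p q.
  by rewrite sqr_enorm !dotE (dotC q p) !dot_unit//; ring.
have /andP[c_ge c_le] := dot_unit_itv p1 q1.
have rdp : r * dot p x = a + b * dot p q.
  by rewrite -dotZr scalerA divff ?gt_eqF// scale1r !dotE dot_unit//; ring.
have rdq : r * dot x q = b + a * dot p q.
  by rewrite -dotZl scalerA divff ?gt_eqF// scale1r !dotE dot_unit//; ring.
have rsin : r * sin (dS2 p x) = b * sin (dS2 p q).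
  apply/eqP; rewrite -(@eqrXn2 _ 2%N)// ?mulr_ge0 ?sin_dS2_ge0 ?(ltW r0)//.
  rewrite !exprMn !sin2cos2 !cos_dS2// !mulrBr -!exprMn rdp mulr1 rsq.
  by apply/eqP; ring.
(* In terms of r = |w|, the claim reads r cos (d p q) <= a + b cos (d p q); the
   triangle inequalities r <= a + b and b - a <= r settle it according to the
   sign of the cosine. *)
have px_le : dS2 p x <= dS2 p q.
  rewrite -ler_cos ?dS2_in// !cos_dS2// -(ler_pM2l r0) rdp.
  have ab_le : 0 <= a * b * (1 - dot p q) by rewrite !mulr_ge0// subr_ge0.
  have ab_ge : 0 <= a * b * (1 + dot p q) by rewrite !mulr_ge0//; lra.
  have [c0|/ltW c0] := leP 0 (dot p q).
    have : r <= a + b.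
      by rewrite -(@ler_pXn2r _ 2%N)// ?nnegrE ?addr_ge0 ?(ltW r0)// rsq; lra.
    by nra.
  have : b - a <= r.
    have [ba|ba] := leP (b - a) 0; first exact: le_trans ba (ltW r0).
    by rewrite -(@ler_pXn2r _ 2%N)// ?nnegrE ?(ltW ba) ?(ltW r0)// rsq; lra.
  by nra.
(* In fact d x q = d p q - d p x: both lie in [0, pi] and have the same cosine. *)
rewrite -lerBrDl le_eqVlt; apply/orP; left; apply/eqP.
apply: cos_inj; rewrite ?dS2_in//.
  by rewrite in_itv/= subr_ge0 px_le lerBlDr (le_trans (dS2_le_pi p1 q1))// lerDl dS2_ge0.
apply: (mulfI (lt0r_neq0 r0)).
rewrite cosB !cos_dS2// rdq mulrDr mulrCA rdp [r * (_ * _)]mulrCA rsin.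
rewrite mulrCA -expr2 sin2cos2 cos_dS2//; ring.
Qed.

Lemma sin_le (h : R) : 0 <= h <= pi -> h * cos h <= sin h <= h.
Proof.
move=> /andP[h0 hpi].
have [t /[!in_itv]/= /andP[t0 th]] := @MVT_segment _ sin cos 0 h h0
  (fun u _ => is_derive_sin u)
  (continuous_subspaceT (@continuous_sin R)).
rewrite sin0 !subr0 => ->; rewrite mulrC.
rewrite ler_wpM2r//= ?ler_piMl ?cos_le1//.
by rewrite ler_cos ?in_itv//= ?h0 ?t0//= (le_trans th).
Qed.

Lemma enorm_chord x y : enorm x = 1 -> enorm y = 1 ->
  enorm (x - y) = 2 * sin (dS2 x y / 2).
Proof.
move=> x1 y1; apply/eqP; rewrite -(@eqrXn2 _ 2%N)// ?enorm_ge0//; last first.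
  rewrite mulr_ge0// sin_ge0_pi// divr_ge0 ?dS2_ge0//=.
  by have := dS2_le_pi x1 y1; have := dS2_ge0 x1 y1; lra.
rewrite sqr_enorm !dotE (dotC y x) !dot_unit// -cos_dS2//.
have -> : cos (dS2 x y) = cos (dS2 x y / 2 *+ 2) by congr cos; rewrite mulr2n; lra.
by rewrite cos_mulr2n cos2sin2; apply/eqP; ring.
Qed.

Lemma chord_le_dS2 x y : enorm x = 1 -> enorm y = 1 -> enorm (x - y) <= dS2 x y.
Proof.
move=> x1 y1; rewrite enorm_chord//.
have := @sin_le (dS2 x y / 2); have := dS2_le_pi x1 y1; have := dS2_ge0 x1 y1.
by move=> d0 dpi /(_ _)/andP[]; lra.
Qed.

(** A quantitative form of the fact that arc and chord agree to first order,
    from [h * cos h <= sin h] with [h] half the arc. *)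
Lemma dS2_le_chord x y : enorm x = 1 -> enorm y = 1 -> enorm (x - y) <= 1 ->
  dS2 x y <= enorm (x - y) + enorm (x - y) ^+ 2.
Proof.
move=> x1 y1; have := enorm_ge0 (x - y).
have := enorm_chord x1 y1; set e := enorm _ => eE e0 e1.
have d0 := dS2_ge0 x1 y1; have dpi := dS2_le_pi x1 y1.
set h := dS2 x y / 2 in eE *.
have hpi2 : h \in `[- (pi / 2), pi / 2].
  by rewrite in_itv/=; apply/andP; split; rewrite /h; lra.
have h0 : 0 <= h by rewrite /h; lra.
have /andP[hcos _] : h * cos h <= sin h <= h.
  by apply: sin_le; rewrite h0 /h; lra.
have : 1 - e / 2 <= cos h.
  rewrite -(@ler_pXn2r _ 2%N)// ?nnegrE ?cos_ge0_pihalf//; last by lra.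
  by rewrite cos2sin2 (_ : sin h = e / 2); [nra|lra].
have -> : dS2 x y = 2 * h by rewrite /h; lra.
by nra.
Qed.

End SphericalDistance.

(** * Calculus of vector-valued functions *)

Section NormComparison.
Variable R : realType.
Implicit Types u v w : 'rV[R]_3.

Lemma coord_le_norm u i : `|u 0 i| <= `|u|.
Proof.
rewrite [leRHS]mx_normrE.
exact: (le_bigmax _ (fun ij : 'I_1 * 'I_3 => `|u ij.1 ij.2|) (0, i)).
Qed.

Lemma enorm_le_norm u : enorm u <= 2 * `|u|.
Proof.
rewrite -(@ler_pXn2r _ 2%N)// ?nnegrE ?mulr_ge0 ?enorm_ge0//.
rewrite sqr_enorm exprMn (@le_trans _ _ (\sum_(i < 3) `|u| ^+ 2))//.
  apply: ler_sum => i _; rewrite -expr2 -real_normK ?num_real//.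
  by rewrite ler_pXn2r ?nnegrE// coord_le_norm.
by rewrite sumr_const card_ord -mulr_natl; have := sqr_ge0 `|u|; lra.
Qed.

Lemma continuous_enorm : continuous (@enorm R).
Proof.
move=> u; apply/(@cvgrPdist_le _ _ _ _ (nbhs_filter u)) => e e0; apply/nbhs_ballP.
exists (e / 2) => [|v]; first by rewrite /= divr_gt0.
rewrite mx_norm_ball /ball_/= => uv.
rewrite (le_trans (enorm_dist_norm _ _))// (le_trans (enorm_le_norm _))//.
by rewrite mulrC -ler_pdivlMr// ltW.
Qed.

End NormComparison.

Section VectorCalculus.
Variable R : realType.
Implicit Types f : R -> 'rV[R]_3.

Lemma derivative_on_approx a b f f' s e : derivative_on a b f f' ->
  s \in `[a, b] -> 0 < e ->
  exists2 d, 0 < d & forall u, u \in `[a, b] -> `|u - s| < d ->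
    enorm (f u - f s - (u - s) *: f' s) <= e * `|u - s|.
Proof.
move=> df sab e0; have /cvgrPdist_le/(_ (e / 2)) := df s sab.
rewrite divr_gt0// => /(_ isT); rewrite near_withinE near_withinE.
move=> /nbhs_ballP[d /= d0 dP].
exists d => // u uab us.
have [->|us0] := eqVneq u s; first by rewrite !subrr scale0r subr0 enorm0 normr0 mulr0.
have := dP u; rewrite /ball/= distrC => /(_ us us0 uab) fu.
have us0' : u - s != 0 by rewrite subr_eq0.
have -> : f u - f s - (u - s) *: f' s =
  (u - s) *: ((u - s)^-1 *: (f u - f s) - f' s).
  by rewrite scalerBr scalerA mulfV// scale1r.
rewrite enormZ mulrC ler_wpM2r// (le_trans (enorm_le_norm _))//.
by rewrite mulrC -ler_pdivlMr// distrC.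
Qed.

(** Vector-valued functions have no mean value theorem; testing against a fixed
    vector reduces to the scalar one. *)
Lemma derivative_on_MVT a b f f' u w e : derivative_on a b f f' ->
  a <= u -> u < w -> w <= b ->
  exists2 x, x \in `[u, w] & dot (f w - f u) e = dot (f' x) e * (w - u).
Proof.
move=> df au uw wb.
have sub x : x \in `[u, w] -> x \in `[a, b].
  rewrite !in_itv/= => /andP[ux xw].
  by rewrite (le_trans au ux) (le_trans xw wb).
have approx s eps : s \in `[u, w] -> 0 < eps ->
    exists2 d, 0 < d & forall t, t \in `[a, b] -> `|t - s| < d ->
    `|dot (f t) e - dot (f s) e - (t - s) * dot (f' s) e| <= eps * `|t - s|.
  move=> /sub sab eps0.
  (* The + 1 avoids a division by zero when e is null. *)
  have [|d d0 dP] := @derivative_on_approx a b f f' s (eps / (enorm e + 1)) df sab.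
    by rewrite divr_gt0// ltr_wpDl ?enorm_ge0.
  exists d => // t tab /(dP _ tab) bnd.
  rewrite -dotZl -!dotNl -!dotDl (le_trans (normr_dot_le _ _))//.
  rewrite (le_trans (ler_wpM2r (enorm_ge0 _) bnd))//.
  rewrite mulrAC ler_wpM2r// -mulrA ler_piMr ?(ltW eps0)//.
  by rewrite mulrC ler_pdivrMr ?mul1r ?lerDl// ltr_wpDl ?enorm_ge0.
have [||x xuw] := @MVT_segment _ (fun x => dot (f x) e)
    (fun x => dot (f' x) e) u w (ltW uw).
- move=> x; rewrite in_itv/= => /andP[ux xw].
  suff : h^-1 *: (dot (f (h *: 1 + x)) e - dot (f x) e) @[h --> 0^'] --> dot (f' x) e.
    move=> lim; apply: DeriveDef; first exact: cvgP lim.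
    exact: cvg_lim lim.
  apply/cvgrPdist_le => eps eps0.
  have [|d d0 dP] := approx x eps _ eps0; first by rewrite in_itv/= !ltW.
  near=> h.
  have h0 : h != 0 by near: h; exact: nbhs_dnbhs_neq.
  have hd : `|h| < d by near: h; exact: dnbhs0_lt.
  have : `|h| < Num.min (x - u) (w - x).
    by near: h; apply: dnbhs0_lt; rewrite lt_min !subr_gt0 ux.
  rewrite lt_min !ltr_norml => /andP[/andP[hl _] /andP[_ hr]].
  have hE : h *: 1 + x - x = h by rewrite addrK [_ *: _]mulr1.
  have := dP (h *: 1 + x); rewrite hE => /(_ _ hd)/wrap[|bnd].
    by apply: sub; rewrite in_itv/= [_ *: _]mulr1; apply/andP; split; lra.
  rewrite distrC [_ *: (_ - _)](_ : _ = h^-1 * (dot (f (h *: 1 + x)) e - dot (f x) e))//.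
  rewrite -(@ler_pM2l _ `|h|) ?normr_gt0// -normrM mulrBr mulrA divff// mul1r.
  by rewrite [leRHS]mulrC.
- apply/subspace_continuousP => s suw; apply/cvgrPdist_le => eps eps0.
  have [d d0 dP] := approx s 1 suw ltr01.
  set m := 1 + `|dot (f' s) e|.
  have m0 : 0 < m by rewrite ltr_wpDr.
  rewrite near_withinE; apply/nbhs_ballP.
  exists (Num.min d (eps / m)); first by rewrite /= lt_min d0 divr_gt0.
  move=> t; rewrite /ball/= distrC lt_min => /andP[td te] tuw.
  have := dP t (sub _ tuw) td; rewrite mul1r => bnd.
  rewrite distrC.
  apply: (@le_trans _ _ (m * `|t - s|)); last by rewrite mulrC -ler_pdivlMr// ltW.
  rewrite -(subrK ((t - s) * dot (f' s) e) (_ - _)).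
  by rewrite (le_trans (ler_normD _ _))// [leRHS]mulrDl mul1r lerD// normrM mulrC.
- by rewrite dotDl dotNl => ->; exists x.
Unshelve. all: by end_near. Qed.
End VectorCalculus.

Section MeanValue.
Variable R : realType.
Implicit Types f : R -> 'rV[R]_3.

(** Test the left-hand side against itself. *)
Lemma mean_value_ineq a b f f' u w v M : derivative_on a b f f' ->
  a <= u -> u <= w -> w <= b ->
  (forall x, x \in `[u, w] -> enorm (f' x - v) <= M) ->
  enorm (f w - f u - (w - u) *: v) <= M * (w - u).
Proof.
move=> df au; rewrite le_eqVlt => /predU1P[<- _ _|uw wb bnd].
  by rewrite !subrr scale0r subr0 enorm0 mulr0.
set D := f w - f u - (w - u) *: v.
have [->|D0] := eqVneq D 0.
  rewrite enorm0 mulr_ge0// ?subr_ge0 ?(ltW uw)//.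
  by apply: (le_trans (enorm_ge0 _) (bnd u _)); rewrite in_itv/= lexx ltW.
have [x xuw Dx] := derivative_on_MVT D df au uw wb.
rewrite -(@ler_pM2r _ (enorm D)) ?enorm_gt0// -expr2 sqr_enorm {1}/D.
rewrite dotDl Dx dotNl dotZl mulrC -mulrBr -dotNl -dotDl mulrAC mulrC.
rewrite ler_wpM2r ?subr_ge0 ?(ltW uw)//.
by rewrite (le_trans (dot_le_enorm _ _))// ler_wpM2r ?enorm_ge0 ?bnd.
Qed.

Lemma lipschitz_of_derivative a b f f' K x y : derivative_on a b f f' ->
  (forall x, x \in `[a, b] -> enorm (f' x) <= K) ->
  x \in `[a, b] -> y \in `[a, b] ->
  enorm (f x - f y) <= K * `|x - y|.
Proof.
move=> df bnd.
wlog yx : x y / y <= x => [wl xab yab|].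
  have [|/ltW] := leP y x; first by move=> yx; exact: wl.
  by move=> xy; rewrite enormBC distrC; exact: wl.
rewrite !in_itv/= => /andP[ax xb] /andP[ay yb].
have := @mean_value_ineq a b f f' y x 0 K df ay yx xb.
rewrite scaler0 subr0 (ger0_norm (x := x - y)) ?subr_ge0//; apply => z.
rewrite in_itv/= => /andP[yz zx]; rewrite subr0 bnd// in_itv/=.
by rewrite (le_trans ay)// (le_trans zx).
Qed.

Lemma uniformly_continuous_on a b f e : {within `[a, b], continuous f} ->
  0 < e -> exists2 d, 0 < d & forall x y, x \in `[a, b] -> y \in `[a, b] ->
    `|x - y| <= d -> enorm (f x - f y) <= e.
Proof.
move=> /subspace_continuousP fcont e0.
have /compact_near_coveringP/(_ _ (0^'+)
  (fun d x => x \in `[a, b] -> forall y, y \in `[a, b] ->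
    `|x - y| <= d -> enorm (f x - f y) <= e)) :=
  @segment_compact R a b.
case=> [x /fcont /cvgrPdist_le/(_ (e / 4))|/= r /= r0 rP].
  rewrite divr_gt0// => /(_ isT); rewrite near_withinE => /nbhs_ballP[d /= d0 dP].
  have near_x y : y \in `[a, b] -> `|x - y| < d -> enorm (f x - f y) <= e / 2.
    move=> yab xy; have -> : e / 2 = 2 * (e / 4) by lra.
    by rewrite (le_trans (enorm_le_norm _))// ler_pM2l//; exact: dP.
  exists (ball x (d / 2), [set r | r < d / 2]) => /=.
    split; first by apply: nbhsx_ballx; rewrite divr_gt0.
    by apply: nbhs_right_lt; rewrite divr_gt0.
  move=> [x' t] /= [x'x td] x'ab y yab x'y.
  have x'd : `|x - x'| < d / 2 := x'x.
  have xy : `|x - y| < d.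
    rewrite -(subrKA x') (le_lt_trans (ler_normD _ _))//.
    by rewrite [ltRHS]splitr ltrD// (le_lt_trans x'y).
  rewrite (le_trans (enorm_dist (f x) _ _))// (splitr e) lerD ?near_x//.
  by rewrite enormBC near_x// (lt_trans x'd)// ltr_pdivrMr// ltr_pMr// ltr1n.
have r2 : 0 < r / 2 by rewrite divr_gt0.
exists (r / 2) => // x y xab yab xy.
apply: (rP (r / 2)) => //=; rewrite sub0r normrN gtr0_norm//.
by rewrite ltr_pdivrMr// mulr_natr mulr2n ltrDl.
Qed.

Lemma continuous_enorm_on a b f : {within `[a, b], continuous f} ->
  {within `[a, b], continuous (fun x => enorm (f x))}.
Proof.
move=> /subspace_continuousP fcont; apply/subspace_continuousP => x xab.
exact: (cvg_comp _ _ (fcont x xab) (@continuous_enorm R (f x))).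
Qed.

End MeanValue.

(** * Curves parameterized by arc length *)

Section ArcLength.
Variable R : realType.
Implicit Types c : R -> 'rV[R]_3.

Lemma length_poly_cons (p q : 'rV[R]_3) P :
  length_poly [:: p, q & P] = enorm (q - p) + length_poly (q :: P).
Proof.
rewrite /length_poly /segments !big_filter /= big_cons.
by case: eqP => // ->; rewrite enorm0 add0r.
Qed.

Lemma enorm_le_curve_length c u w :
  u < w -> ((enorm (c w - c u))%:E <= curve_length c u w)%E.
Proof.
move=> uw; apply: ereal_sup_ubound; exists [:: w]; first by split=> //=; rewrite uw.
by rewrite length_poly_cons /length_poly big_nil addr0.
Qed.

Lemma curve_length_le a b c c1 M u w : derivative_on a b c c1 ->
  a <= u -> w <= b -> (forall x, x \in `[u, w] -> enorm (c1 x) <= M) ->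
  (curve_length c u w <= (M * (w - u))%:E)%E.
Proof.
move=> dc au wb bnd; apply: ge_ereal_sup => _ [l [lp /eqP lw] <-].
rewrite lee_fin; have {lp lw}lpart : itv_partition u w l by split; last exact/eqP.
elim: l u au lpart bnd => [|x l IH] u au lpart bnd.
  by rewrite /length_poly big_nil (itv_partition_nil lpart) subrr mulr0.
have xpart := itv_partition_cons lpart; have xw := itv_partition_le xpart.
have ux : u < x by case: lpart => /andP[].
rewrite length_poly_cons.
have -> : M * (w - u) = M * (x - u) + M * (w - x) by ring.
apply: lerD; last first.
  apply: IH => //; first by rewrite (le_trans au)// ltW.
  move=> y; rewrite in_itv/= => /andP[xy yw]; apply: bnd.
  by rewrite in_itv/= yw (le_trans (ltW ux)).
have := @mean_value_ineq _ a b c c1 u x 0 M dc au (ltW ux) (le_trans xw wb).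
rewrite scaler0 subr0; apply => y; rewrite in_itv/= => /andP[uy yx].
by rewrite subr0; apply: bnd; rewrite in_itv/= uy (le_trans yx).
Qed.

(** On a short interval of length [h], [c1] is within [e] of [c1 s].  The arc then
    has length at most [(|c1 s| + e) * h], and at least its chord
    [(|c1 s| - e) * h]; but this length is [h]. *)
Lemma arclength_unit_speed L c c1 K s : 0 < L -> derivative_on 0 L c c1 ->
  arclength_param c 0 L ->
  (forall x y, x \in `[0, L] -> y \in `[0, L] ->
    enorm (c1 x - c1 y) <= K * `|x - y|) ->
  s \in `[0, L] -> enorm (c1 s) = 1.
Proof.
move=> L0 dc arc lip sL.
have K0 : 0 <= K.
  have := lip L 0; rewrite subr0 !in_itv/= !lexx (ltW L0) => /(_ isT isT).
  by rewrite gtr0_norm// => /(le_trans (enorm_ge0 _)); rewrite pmulr_lge0.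
have key e : 0 < e -> `|enorm (c1 s) - 1| <= e.
  move=> e0; pose d := Num.min (e / (K + 1)) (L / 2).
  have d0 : 0 < d by rewrite lt_min !divr_gt0// ltr_wpDl.
  (* As d <= L / 2, an interval of length d fits on one side of s. *)
  have [u [w [u0 uw wL near_s]]] : exists u w, [/\ 0 <= u, u < w, w <= L &
      forall x, x \in `[u, w] -> `|x - s| <= d].
    have dL : d <= L / 2 by rewrite ge_min lexx orbT.
    move: sL; rewrite in_itv/= => /andP[s0 sL].
    have [sd|sd] := leP (s + d) L.
      exists s, (s + d); split=> [|||x]; [lra|lra|lra|].
      by rewrite in_itv/= ler_norml => /andP[]; lra.
    exists (s - d), s; split=> [|||x]; [lra|lra|lra|].
    by rewrite in_itv/= ler_norml => /andP[]; lra.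
  have inL x : x \in `[u, w] -> x \in `[0, L].
    rewrite !in_itv/= => /andP[ux xw].
    by rewrite (le_trans u0 ux) (le_trans xw wL).
  have close x : x \in `[u, w] -> enorm (c1 x - c1 s) <= e.
    move=> xuw; rewrite (le_trans (lip _ _ (inL _ xuw) sL))//.
    rewrite (le_trans (ler_wpM2l K0 (near_s _ xuw)))//.
    have : d <= e / (K + 1) by rewrite ge_min lexx.
    rewrite ler_pdivlMr ?ltr_wpDl//; apply: le_trans.
    by rewrite mulrC ler_wpM2l ?lerDl// ltW.
  have wu : 0 < w - u by rewrite subr_gt0.
  have len : curve_length c u w = (w - u)%:E by apply: arc; rewrite ?(ltW uw).
  rewrite ler_norml; apply/andP; split.
    have := @curve_length_le 0 L c c1 (enorm (c1 s) + e) u w dc u0 wL.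
    rewrite len lee_fin -[leLHS]mul1r ler_pM2r// => /(_ _)/wrap[x xuw|].
      by have := enormD (c1 x - c1 s) (c1 s); have := close x xuw; rewrite subrK; lra.
    by lra.
  have := enorm_le_curve_length c uw; rewrite len lee_fin => cwu.
  have := @mean_value_ineq _ 0 L c c1 u w (c1 s) e dc u0 (ltW uw) wL close.
  have := enormD (c w - c u) (- (c w - c u - (w - u) *: c1 s)).
  rewrite enormN opprB addrC subrK enormZ gtr0_norm// => h1 h2.
  by rewrite -(ler_pM2r wu); lra.
by apply/eqP; rewrite -subr_eq0 -normr_le0; apply/ler_addgt0Pl => e /key; rewrite addr0.
Qed.

End ArcLength.

(** * Bounds for the integral of a continuous function *)

Section IntegralBounds.
Variables (R : realType) (L : R) (g : R -> R).
Hypothesis g_cont : {within `[0, L], continuous g}.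

Let k s := \int[lebesgue_measure]_(x in `[0, s]) g x.

Let integrable_segment a b : 0 <= a -> b <= L ->
  lebesgue_measure.-integrable `[a, b] (EFin \o g).
Proof.
move=> a0 bL; apply: continuous_compact_integrable; first exact: segment_compact.
by apply: continuous_subspaceW g_cont; apply: subset_itv; rewrite bnd_simp.
Qed.

Lemma EFin_integral s : s \in `[0, L] ->
  (k s)%:E = (\int[lebesgue_measure]_(x in `[0%R, s]) (g x)%:E)%E.
Proof.
rewrite in_itv/= => /andP[_ sL].
by rewrite /k fineK//; apply: integrable_fin_num => //; exact: integrable_segment.
Qed.

Lemma integral_segment0 : k 0 = 0.
Proof. by rewrite /k set_itv1 Rintegral_set1. Qed.

Let integral_segmentB a b : 0 <= a -> a <= b -> b <= L ->
  k b - k a = \int[lebesgue_measure]_(x in `[a, b]) g x.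
Proof.
move=> a0 ab bL; rewrite -Rintegral_itv_obnd_cbnd.
  by apply: Rintegral_itvB; rewrite ?bnd_simp//; exact: integrable_segment.
by apply: integrableS (integrable_segment a0 bL) => //; exact: subset_itv_oc_cc.
Qed.

Let integral_cst a b (M : R) : a <= b ->
  \int[lebesgue_measure]_(x in `[a, b]) M = M * (b - a).
Proof.
move=> ab; rewrite Rintegral_cst//= lebesgue_measure_itv/= lte_fin.
by case: ltgtP ab => //= -> _; rewrite subrr.
Qed.

Let integrable_cst a b (M : R) :
  lebesgue_measure.-integrable `[a, b] (EFin \o (fun=> M)).
Proof.
apply: continuous_compact_integrable; first exact: segment_compact.
by apply: continuous_subspaceT; exact: cst_continuous.
Qed.

Lemma integral_le a b M : 0 <= a -> a <= b -> b <= L ->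
  (forall x, x \in `[a, b] -> g x <= M) -> k b - k a <= M * (b - a).
Proof.
move=> a0 ab bL bnd; rewrite integral_segmentB// -integral_cst//.
by apply: le_Rintegral => //; exact: integrable_segment.
Qed.

Lemma integral_ge a b m : 0 <= a -> a <= b -> b <= L ->
  (forall x, x \in `[a, b] -> m <= g x) -> m * (b - a) <= k b - k a.
Proof.
move=> a0 ab bL bnd; rewrite integral_segmentB// -integral_cst//.
by apply: le_Rintegral => //; exact: integrable_segment.
Qed.

End IntegralBounds.

(** * Subdivisions and the length of the hodograph *)

Section Grid.
Variable R : realType.

Definition grid (a b : R) n i : R := a + (b - a) / n%:R * i%:R.

Lemma grid0 a b n : grid a b n 0 = a.
Proof. by rewrite /grid mulr0 addr0. Qed.

Lemma gridn a b n : (0 < n)%N -> grid a b n n = b.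
Proof. by move=> n0; rewrite /grid divfK ?pnatr_eq0 -?lt0n// addrC subrK. Qed.

Lemma gridS a b n i : grid a b n i.+1 - grid a b n i = (b - a) / n%:R.
Proof. by rewrite /grid -natr1 mulrDr mulr1; ring. Qed.

Lemma grid_le a b n i j : a <= b -> (i <= j)%N -> grid a b n i <= grid a b n j.
Proof.
by move=> ab ij; rewrite lerD2l ler_wpM2l ?ler_nat// divr_ge0 ?subr_ge0.
Qed.

Lemma grid_lt a b n i j : a < b -> (0 < n)%N -> (i < j)%N ->
  grid a b n i < grid a b n j.
Proof.
move=> ab n0 ij.
by rewrite ltrD2l ltr_pM2l ?ltr_nat// divr_gt0 ?subr_gt0 ?ltr0n.
Qed.

Lemma grid_in a b n i : a <= b -> (0 < n)%N -> (i <= n)%N ->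
  grid a b n i \in `[a, b].
Proof.
move=> ab n0 ni; rewrite in_itv/= -[X in X <= _ <= _](grid0 a b n).
by rewrite -[X in _ <= _ <= X](gridn a b n0) !grid_le.
Qed.

Lemma ex_step_le (a b d : R) : 0 < d ->
  exists n, forall m, (n <= m)%N -> (b - a) / m.+1%:R <= d.
Proof.
move=> d0; exists (Num.truncn (`|b - a| / d)) => m nm.
rewrite ler_pdivrMr// mulrC -ler_pdivrMr//.
apply: (le_trans (y := `|b - a| / d)); first by rewrite ler_pM2r ?invr_gt0// ler_norm.
apply: ltW; apply: lt_le_trans (_ : (Num.truncn (`|b - a| / d)).+1%:R <= _).
  exact: truncnS_gt.
by rewrite ler_nat.
Qed.

(** Add up the local bound over a fine regular subdivision: [F l r] is at most
    [e * (r - l)] for every positive [e]. *)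
Lemma subadditive_le0 (F : R -> R -> R) (l r : R) : l <= r -> F l l <= 0 ->
  (forall x y, l <= x -> x <= y -> y <= r -> F l y <= F l x + F x y) ->
  (forall e, 0 < e -> exists2 d, 0 < d & forall x y, l <= x -> x <= y -> y <= r ->
    y - x <= d -> F x y <= e * (y - x)) ->
  F l r <= 0.
Proof.
move=> lr Fll Fadd Floc; apply/ler_addgt0Pl => e e0; rewrite addr0.
have rl : 0 < r - l + 1 by rewrite ltr_wpDl ?subr_ge0.
have [d d0 dP] := Floc (e / (r - l + 1)) (divr_gt0 e0 rl).
have [n /(_ _ (leqnn n)) step] := ex_step_le l r d0.
have Fgrid i : (i <= n.+1)%N ->
    F l (grid l r n.+1 i) <= e / (r - l + 1) * (grid l r n.+1 i - l).
  elim: i => [_|i IH ni]; first by rewrite grid0 subrr mulr0.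
  have /[!in_itv]/= /andP[li _] := grid_in lr (ltn0Sn n) (ltnW ni).
  have /[!in_itv]/= /andP[_ ri] := grid_in lr (ltn0Sn n) ni.
  have ii : grid l r n.+1 i <= grid l r n.+1 i.+1 by rewrite grid_le.
  rewrite (le_trans (Fadd _ _ li ii ri))//.
  have := dP _ _ li ii ri; rewrite gridS => /(_ step).
  rewrite -(gridS l r n.+1 i).
  by have := IH (ltnW ni); lra.
have := Fgrid _ (leqnn _); rewrite gridn// => /le_trans; apply.
by rewrite mulrAC ler_pdivrMr// ler_wpM2l ?(ltW e0)// lerDl.
Qed.

End Grid.

Section Hodograph.
Variables (R : realType) (L : R) (f f' : R -> 'rV[R]_3).
Hypothesis df : derivative_on 0 L f f'.
Hypothesis f'_cont : {within `[0, L], continuous f'}.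

Let k s := \int[lebesgue_measure]_(x in `[0, s]) enorm (f' x).

(** Both quantities are within [e / 2 * (b - a)] of [|f' a| * (b - a)], by
    uniform continuity of [f']. *)
Lemma increment_vs_integral e : 0 < e ->
  exists2 d, 0 < d & forall a b, 0 <= a -> a <= b -> b <= L -> b - a <= d ->
    `|enorm (f b - f a) - (k b - k a)| <= e * (b - a).
Proof.
move=> e0; have [|d d0 dP] := uniformly_continuous_on f'_cont (e := e / 2).
  by rewrite divr_gt0.
exists d => // a b a0 ab bL bad.
have close x : x \in `[a, b] -> enorm (f' x - f' a) <= e / 2.
  rewrite in_itv/= => /andP[ax xb]; apply: dP.
  - by rewrite in_itv/= (le_trans a0 ax) (le_trans xb bL).
  - by rewrite in_itv/= a0 (le_trans ab bL).
  - by rewrite ger0_norm ?subr_ge0// (le_trans _ bad)// lerB.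
have chord := mean_value_ineq df a0 ab bL close.
have fcont := continuous_enorm_on f'_cont.
have norm_close x : x \in `[a, b] -> `|enorm (f' x) - enorm (f' a)| <= e / 2.
  by move=> /close; exact/le_trans/enorm_dist_norm.
have up : k b - k a <= (enorm (f' a) + e / 2) * (b - a).
  apply: (integral_le fcont) => // x /norm_close.
  by rewrite ler_norml => /andP[]; lra.
have low : (enorm (f' a) - e / 2) * (b - a) <= k b - k a.
  apply: (integral_ge fcont) => // x /norm_close.
  by rewrite ler_norml => /andP[]; lra.
have := enorm_dist_norm (f b - f a) ((b - a) *: f' a).
rewrite enormZ (ger0_norm (x := b - a)) ?subr_ge0// => /le_trans/(_ chord).
by rewrite !ler_norml => /andP[h1 h2]; apply/andP; split; lra.
Qed.

Lemma integral_nondecreasing a b : 0 <= a -> a <= b -> b <= L -> k a <= k b.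
Proof.
move=> a0 ab bL; have := integral_ge (continuous_enorm_on f'_cont) a0 ab bL (m := 0).
by rewrite mul0r subr_ge0; apply => x _; exact: enorm_ge0.
Qed.

Lemma derivative_bounded : 0 <= L ->
  exists2 K, 0 <= K & forall x, x \in `[0, L] -> enorm (f' x) <= K.
Proof.
move=> L0; have [x _ xmax] := EVT_max L0 (continuous_enorm_on f'_cont).
by exists (enorm (f' x)) => //; exact: enorm_ge0.
Qed.

(** Spherical and Euclidean distances agree to first order, so the length of a
    curve on the sphere also bounds the spherical distance of its endpoints. *)
Lemma dS2_le_integral a b : 0 <= L ->
  (forall s, s \in `[0, L] -> enorm (f s) = 1) ->
  0 <= a -> a <= b -> b <= L -> dS2 (f a) (f b) <= k b - k a.
Proof.
move=> L0 f1 a0 ab bL; rewrite -subr_le0.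
have [K K0 Kbnd] := derivative_bounded L0.
have f1' x : a <= x -> x <= b -> enorm (f x) = 1.
  by move=> ax xb; apply: f1; rewrite in_itv/= (le_trans a0 ax) (le_trans xb bL).
apply: (@subadditive_le0 _ (fun x y => dS2 (f x) (f y) - (k y - k x))) => //.
- by rewrite dS2xx ?f1'// !subrr.
- move=> x y ax xy yb.
  have := @dS2_triangle _ (f x) (f a) (f y).
  by rewrite !f1'//; [lra|exact: le_trans xy|exact: le_trans yb].
move=> e e0; have [|d d0 dP] := increment_vs_integral (e := e / 2).
  by rewrite divr_gt0.
have K1 : 0 < K + 1 by lra.
(* With t the chord, of length at most K (y - x): the second bound makes t <= 1,
   and the third one makes t ^ 2, the excess of the arc over the chord, at most
   e / 2 * (y - x). *)
exists (Num.min d (Num.min (K + 1)^-1 (e / (2 * (K + 1) ^+ 2)))).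
  by rewrite !lt_min d0 invr_gt0 K1 divr_gt0// mulr_gt0// exprn_gt0.
move=> x y ax xy yb; rewrite !le_min => /and3P[xyd xyK xye].
have xL : x \in `[0, L] by rewrite in_itv/=; apply/andP; split; lra.
have yL : y \in `[0, L] by rewrite in_itv/=; apply/andP; split; lra.
have := dP x y (le_trans a0 ax) xy (le_trans yb bL) xyd.
rewrite ler_norml => /andP[_ bnd].
have lip := lipschitz_of_derivative df Kbnd xL yL.
rewrite distrC ger0_norm ?subr_ge0// in lip.
have yx0 : 0 <= y - x by rewrite subr_ge0.
move: xyK; rewrite -[(K + 1)^-1]mul1r ler_pdivlMr// => xyK.
move: xye; rewrite ler_pdivlMr ?mulr_gt0 ?exprn_gt0// => xye.
have := @dS2_le_chord _ (f x) (f y).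
rewrite !f1 // => /(_ erefl erefl) d_le.
have e_ge0 := enorm_ge0 (f x - f y).
have chord1 : enorm (f x - f y) <= 1 by nra.
have := d_le chord1; rewrite enormBC in lip e_ge0 chord1 *.
move: (enorm _) bnd lip e_ge0 chord1 => t bnd lip t0 t1 dt.
have : t ^+ 2 <= e / 2 * (y - x).
  have : t ^+ 2 <= (K * (y - x)) ^+ 2 by rewrite ler_pXn2r ?nnegrE ?mulr_ge0.
  by move=> /le_trans; apply; nra.
by lra.
Qed.

End Hodograph.

(** * Directions of chords *)

Section DiscreteMean.
Variable R : realType.
Implicit Types (p : nat -> 'rV[R]_3) (q w : 'rV[R]_3).

(** By induction, merging one more vector into the running sum at a time. *)
Lemma dS2_sum_le p h n : (forall i, (i <= n)%N -> enorm (p i) = 1) -> 0 <= h ->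
  exists q, enorm q = 1 /\
  exists r, [/\ 0 <= r, r *: q = h *: \sum_(i < n.+1) p i
    & dS2 (p 0) q + dS2 q (p n) <= \sum_(i < n) dS2 (p i) (p i.+1)].
Proof.
move=> + h0; elim: n => [|n IH] p1.
  exists (p 0); split; first exact: p1.
  by exists h; split; rewrite ?big_ord1// big_ord0 !dS2xx ?p1// addr0.
have [|q [q1 [r [r0 rq qle]]]] := IH; first by move=> i ni; apply: p1; exact: leqW.
have [x [x1 [r' [r'0 r'x xle]]]] := dS2_cone q1 (p1 _ (leqnn _)) r0 h0.
exists x; split=> //; exists r'; split=> //.
  by rewrite r'x rq -scalerDr [in RHS]big_ord_recr.
rewrite big_ord_recr/=.
have := dS2_triangle (p1 0 (leq0n _)) q1 x1.
have := dS2_triangle q1 (p1 n (leqnSn _)) (p1 _ (leqnn _)).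
by lra.
Qed.

Lemma normalize_close q r w e : enorm q = 1 -> 0 <= r -> w != 0 ->
  enorm (r *: q - w) <= e ->
  enorm (q - (enorm w)^-1 *: w) <= 2 * e / enorm w.
Proof.
move=> q1 r0 w0 qw; have nw0 : 0 < enorm w by rewrite enorm_gt0.
rewrite ler_pdivlMr// mulrC -{1}(gtr0_norm nw0) -enormZ scalerBr.
rewrite scalerA divff ?gt_eqF// scale1r.
have := enorm_dist (r *: q) (enorm w *: q) w.
rewrite -scalerBl enormZ q1 mulr1.
have := enorm_dist_norm (r *: q) w; rewrite enormZ q1 mulr1 (ger0_norm r0) distrC.
by lra.
Qed.

End DiscreteMean.

Section Chords.
Variables (R : realType) (L : R) (c c1 c2 : R -> 'rV[R]_3).
Hypothesis L0 : 0 <= L.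
Hypothesis dc : derivative_on 0 L c c1.
Hypothesis dc1 : derivative_on 0 L c1 c2.
Hypothesis c2_cont : {within `[0, L], continuous c2}.
Hypothesis unit_speed : forall s, s \in `[0, L] -> enorm (c1 s) = 1.

Let k s := \int[lebesgue_measure]_(x in `[0, s]) enorm (c2 x).

Lemma chord_approx K a b : (forall x, x \in `[0, L] -> enorm (c2 x) <= K) ->
  0 <= K -> 0 <= a -> a <= b -> b <= L ->
  enorm (c b - c a - (b - a) *: c1 a) <= K * (b - a) * (b - a).
Proof.
move=> Kbnd K0 a0 ab bL; apply: (mean_value_ineq dc) => // x.
rewrite in_itv/= => /andP[ax xb].
have xL : x \in `[0, L] by rewrite in_itv/=; apply/andP; split; lra.
have aL : a \in `[0, L] by rewrite in_itv/=; apply/andP; split; lra.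
rewrite (le_trans (lipschitz_of_derivative dc1 Kbnd xL aL))//.
by rewrite ler_wpM2l// ger0_norm ?subr_ge0// lerB.
Qed.

(** The chord is the limit of Riemann sums of the unit vectors [c1], to which
    [dS2_sum_le] applies. *)
Lemma dS2_chord_le a b : 0 <= a -> a <= b -> b <= L ->
  let w := c b - c a in w != 0 ->
  dS2 (c1 a) ((enorm w)^-1 *: w) + dS2 ((enorm w)^-1 *: w) (c1 b) <= k b - k a.
Proof.
move=> a0 ab bL w w0; have [K K0 Kbnd] := derivative_bounded c2_cont L0.
have nw0 : 0 < enorm w by rewrite enorm_gt0.
set v := _ *: w; have v1 : enorm v = 1 by exact: enorm_normalize.
apply/ler_addgt0Pr => e e0.
(* If q is within t of v, then their spherical distance is at most
   t + t ^ 2 <= 2 t <= e / 2; eta is the accuracy required from the Riemann sum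
   to ensure this after normalization. *)
pose t := Num.min 1 (e / 4).
have t0 : 0 < t by rewrite lt_min ltr01 divr_gt0.
have [t1 te] : t <= 1 /\ t <= e / 4 by rewrite /t !ge_min !lexx orbT.
pose eta := enorm w * t / 2.
have eta0 : 0 < eta by rewrite divr_gt0// mulr_gt0.
have Kba : 0 < K * (b - a) + 1 by rewrite ltr_wpDl// mulr_ge0// subr_ge0.
have [n /(_ _ (leqnn n))] := ex_step_le a b (divr_gt0 eta0 Kba).
set h := (b - a) / _ => h_le.
have h0 : 0 <= h by rewrite divr_ge0// subr_ge0.
pose x := grid a b n.+1.
have x_ge i : a <= x i by rewrite -(grid0 a b n.+1) grid_le.
have x_mon i : x i <= x i.+1 by rewrite grid_le.
have x_le i : (i <= n.+1)%N -> x i <= b.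
  by move=> ni; have /[!in_itv]/= /andP[] := grid_in ab (ltn0Sn n) ni.
have xS i : x i.+1 - x i = h by exact: gridS.
have x_in i : (i <= n.+1)%N -> x i \in `[0, L].
  by move=> /x_le xi; rewrite in_itv/= (le_trans a0 (x_ge i)) (le_trans xi bL).
have [|q [q1 [r [r0 rq qle]]]] := @dS2_sum_le _ (c1 \o x) h n _ h0.
  by move=> i ni; apply: unit_speed; apply: x_in; exact: leqW.
have riemann : enorm (r *: q - w) <= eta.
  have -> : w = \sum_(i < n.+1) (c (x i.+1) - c (x i)).
    rewrite -(big_mkord xpredT (fun i => c (x i.+1) - c (x i))) (telescope_sumr (c \o x))//=.
    by rewrite /x gridn// grid0.
  rewrite rq scaler_sumr -sumrB (le_trans (enorm_sum _ _))//.
  rewrite (@le_trans _ _ (\sum_(i < n.+1) K * h * h))//.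
    apply: ler_sum => i _; rewrite /= enormBC -(xS i); apply: chord_approx => //.
      exact: le_trans a0 (x_ge i).
    by apply: le_trans bL; apply: x_le.
  rewrite sumr_const card_ord -mulr_natl mulrC.
  have hn : h * n.+1%:R = b - a by rewrite /h divfK// pnatr_eq0.
  rewrite (_ : K * h * h * _ = K * h * (b - a)); last by rewrite -hn; ring.
  by move: h_le; rewrite ler_pdivlMr//; nra.
have qv := normalize_close q1 r0 w0 riemann.
have {}qv : enorm (q - v) <= t.
  apply: le_trans qv _; rewrite ler_pdivrMr// /eta; lra.
have qv_dS2 : dS2 q v <= e / 2.
  rewrite (le_trans (dS2_le_chord q1 v1 (le_trans qv t1)))//.
  have := enorm_ge0 (q - v); nra.
have arcs : \sum_(i < n) dS2 ((c1 \o x) i) ((c1 \o x) i.+1) + dS2 (c1 (x n)) (c1 b)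
    <= k b - k a.
  have -> : b = x n.+1 by rewrite /x gridn.
  rewrite -[X in X <= _](big_ord_recr n (fun i => dS2 (c1 (x i)) (c1 (x i.+1)))).
  have -> : k a = k (x 0) by rewrite /x grid0.
  rewrite -[leRHS](@telescope_sumr _ 0 n.+1 (k \o x))// big_mkord.
  apply: ler_sum => i _; apply: (dS2_le_integral dc1) => //.
    exact: le_trans a0 (x_ge i).
  by apply: le_trans bL; apply: x_le.
have a_x : a = x 0 by rewrite /x grid0.
have aL : a \in `[0, L] by rewrite a_x x_in.
have bL' : b \in `[0, L] by rewrite in_itv/= bL (le_trans a0).
have xnL := x_in _ (leqnSn n).
have := dS2_triangle (unit_speed aL) q1 v1.
have := dS2_triangle v1 q1 (unit_speed bL').
have := dS2_triangle q1 (unit_speed xnL) (unit_speed bL').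
move: qle; rewrite /= -a_x (dS2C v q).
by lra.
Qed.

End Chords.

(** * Total curvature of inscribed polygonals *)

Section SphericalPaths.
Variable R : realType.
Implicit Types (x y : 'rV[R]_3) (s t P : seq 'rV[R]_3).

Fixpoint path_length x s : R :=
  if s is y :: s' then dS2 x y + path_length y s' else 0.

Lemma cumulative0 t : cumulative t 0 = 0.
Proof. by rewrite /cumulative big_geq. Qed.

Lemma cumulative_cons x s i :
  cumulative (x :: s) i.+1 = dS2 x s`_0 + cumulative s i.
Proof. by rewrite /cumulative big_nat_recl. Qed.

Lemma cumulativeS t i : cumulative t i.+1 = cumulative t i + dS2 t`_i t`_i.+1.
Proof. by rewrite /cumulative big_nat_recr. Qed.

Lemma cumulative_size x s : cumulative (x :: s) (size s) = path_length x s.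
Proof.
elim: s x => [|y s IH] x /=; first exact: cumulative0.
by rewrite cumulative_cons/= IH.
Qed.

Lemma path_length_rcons x s y :
  path_length x (rcons s y) = path_length x s + dS2 (last x s) y.
Proof. by elim: s x => [|z s IH] x /=; rewrite ?addr0 ?add0r// IH addrA. Qed.

Lemma cumulative_cat s t i : (i < size s)%N ->
  cumulative (s ++ t) i = cumulative s i.
Proof.
move=> i_s; apply: eq_big_nat => j /andP[_ ji].
by rewrite !nth_cat (ltn_trans ji)// (leq_ltn_trans ji).
Qed.

Definition on_sphere s := {in s, forall x, enorm x = 1}.

Lemma cumulative_le t i j : on_sphere t -> (i <= j)%N -> (j < size t)%N ->
  cumulative t i <= cumulative t j.
Proof.
move=> t1; elim: j => [|j IH]; first by rewrite leqn0 => /eqP->.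
rewrite leq_eqVlt => /predU1P[->//|]; rewrite ltnS => ij jt.
rewrite cumulativeS (le_trans (IH ij (ltnW jt)))// lerDl.
by rewrite dS2_ge0// t1// mem_nth// ltnW.
Qed.

Lemma cumulative_ge0 t i : on_sphere t -> (i < size t)%N -> 0 <= cumulative t i.
Proof. by move=> t1 it; rewrite -(cumulative0 t) cumulative_le. Qed.

Lemma tangents_cons p q P : tangents false [:: p, q & P] =
  if q - p == 0 then tangents false (q :: P)
  else (enorm (q - p))^-1 *: (q - p) :: tangents false (q :: P).
Proof. by rewrite /tangents /segments /=; case: eqP. Qed.

Lemma tangents_on_sphere cyc P : on_sphere (tangents cyc P).
Proof.
have sphere0 : on_sphere (tangents false P).
  move=> _ /mapP[w + ->]; rewrite mem_filter => /andP[w0 _].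
  exact: enorm_normalize.
case: cyc => // x; rewrite /tangents mem_cat => /orP[|/mem_take]; exact: sphere0.
Qed.

Lemma TCpoly_ge0 cyc P : 0 <= TCpoly cyc P.
Proof.
rewrite /TCpoly; case tE : (tangents cyc P) => [|x s].
  by rewrite cumulative0.
by apply: cumulative_ge0; rewrite // -tE; exact: tangents_on_sphere.
Qed.

(** Closing the polygonal only appends an arc to its indicatrix. *)
Lemma cumulative_le_TCpoly cyc P i : (i < size (tangents false P))%N ->
  cumulative (tangents false P) i <= TCpoly cyc P.
Proof.
move=> it; have T0 := leq_ltn_trans (leq0n i) it.
have := @tangents_on_sphere cyc P; rewrite /TCpoly.
case: cyc => t1; last first.
  by apply: cumulative_le; rewrite // ?ltn_predL// -ltnS prednK.
rewrite -(cumulative_cat (take 1 (tangents false P)) it).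
apply: cumulative_le => //; last by rewrite ltn_predL size_cat addn_gt0 T0.
by rewrite /= size_cat size_takel// addn1 ltnW.
Qed.

End SphericalPaths.

Section InscribedBound.
Variables (R : realType) (L : R) (c c1 c2 : R -> 'rV[R]_3).
Hypothesis L0 : 0 <= L.
Hypothesis dc : derivative_on 0 L c c1.
Hypothesis dc1 : derivative_on 0 L c1 c2.
Hypothesis c2_cont : {within `[0, L], continuous c2}.
Hypothesis unit_speed : forall s, s \in `[0, L] -> enorm (c1 s) = 1.

Let k s := \int[lebesgue_measure]_(x in `[0, s]) enorm (c2 x).

(** Enclosing the tangents between [c1 a] and [c1 b] is what makes induction on
    the partition work: corners are cut at [c1 x], and a null chord, which has no
    direction, is replaced by the arc of hodograph itself. *)
Lemma path_length_inscribed a b l : itv_partition a b l -> 0 <= a -> b <= L ->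
  path_length (c1 a) (rcons (tangents false (inscribed c a l)) (c1 b))
    <= k b - k a.
Proof.
elim: l a => [|x l IH] a part a0 bL.
  have aL : a \in `[0, L] by rewrite in_itv/= a0 (itv_partition_nil part).
  by rewrite -(itv_partition_nil part) /= dS2xx ?unit_speed// addr0 subrr.
have xpart := itv_partition_cons part; have xb := itv_partition_le xpart.
have /ltW ax : a < x by case: part => /andP[].
have x0 := le_trans a0 ax; have xL := le_trans xb bL.
have {IH} := IH _ xpart x0 bL.
have a1 : enorm (c1 a) = 1 by rewrite unit_speed// in_itv/= a0 (le_trans ax).
have x1 : enorm (c1 x) = 1 by rewrite unit_speed// in_itv/= x0.
have b1 : enorm (c1 b) = 1 by rewrite unit_speed// in_itv/= bL (le_trans x0).
have -> : inscribed c a (x :: l) = [:: c a, c x & map c l] by [].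
rewrite tangents_cons -[c x :: map c l]/(inscribed c x l).
have := @tangents_on_sphere _ false (inscribed c x l).
set T := tangents _ _ => T1.
have triangle y : enorm y = 1 ->
    path_length y (rcons T (c1 b)) <= dS2 y (c1 x) + path_length (c1 x) (rcons T (c1 b)).
  move=> y1; case: T T1 => [|z s] /= T1.
    by rewrite !addr0 dS2_triangle.
  by rewrite addrA lerD2r dS2_triangle// T1// mem_head.
have [_|w0] := eqVneq (c x - c a) 0.
  have := triangle _ a1; have := dS2_le_integral dc1 c2_cont L0 unit_speed a0 ax xL.
  by rewrite -/(k a) -/(k x); lra.
have := triangle _ (enorm_normalize w0).
have := dS2_chord_le L0 dc dc1 c2_cont unit_speed a0 ax xL w0.
by rewrite -/(k a) -/(k x)/=; lra.
Qed.

(** When the curve closes up, the arc that joins the last tangent to the first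
    one is at most the detour through [c1 b = c1 a]. *)
Lemma TCpoly_le (cyc : bool) a b l : itv_partition a b l -> 0 <= a -> b <= L ->
  (cyc -> c1 a = c1 b) -> TCpoly cyc (inscribed c a l) <= k b - k a.
Proof.
move=> part a0 bL closed; have := path_length_inscribed part a0 bL.
have ab := itv_partition_le part.
have a1 : enorm (c1 a) = 1 by rewrite unit_speed// in_itv/= a0 (le_trans ab).
have b1 : enorm (c1 b) = 1 by rewrite unit_speed// in_itv/= bL (le_trans a0).
have := @tangents_on_sphere _ false (inscribed c a l).
rewrite /TCpoly; case: cyc closed => [/(_ isT) c1ab|_]; last first.
  case: (tangents _ _) => [|x s] T1.
    by rewrite /= cumulative0; apply: le_trans; rewrite addr0 dS2_ge0.
  rewrite /= cumulative_size; apply: le_trans; rewrite path_length_rcons.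
  have := dS2_ge0 a1 (T1 x (mem_head _ _)).
  have := dS2_ge0 (T1 (last x s) (mem_last _ _)) b1.
  by lra.
have -> : tangents true (inscribed c a l) = tangents false (inscribed c a l) ++
  take 1 (tangents false (inscribed c a l)) by [].
case: (tangents false _) => [|x s] T1.
  by rewrite /= cumulative0; apply: le_trans; rewrite addr0 dS2_ge0.
rewrite /= take0 cats1 cumulative_size !path_length_rcons/=.
have x1 := T1 x (mem_head _ _); have l1 := T1 (last x s) (mem_last _ _).
have := dS2_triangle l1 b1 x1; rewrite -c1ab; lra.
Qed.

End InscribedBound.

(** * Fine regular polygonals *)

Section GridPartition.
Variable R : realType.

Lemma differences_map (V : zmodType) (f : nat -> V) m n :
  differences [seq f i | i <- iota m n.+1] = [seq f i.+1 - f i | i <- iota m n].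
Proof.
rewrite /differences/=; elim: n m => [//|n IH] m /=.
by rewrite IH.
Qed.

Definition grid_partition (L : R) n : seq R := [seq grid 0 L n i | i <- iota 1 n].

Lemma cons_grid_partition (L : R) n :
  0 :: grid_partition L n = [seq grid 0 L n i | i <- iota 0 n.+1].
Proof. by rewrite /= grid0. Qed.

Lemma grid_partitionP (L : R) n : 0 < L -> (0 < n)%N ->
  itv_partition 0 L (grid_partition L n).
Proof.
move=> L0 n0; split.
  rewrite -[path _ _ _]/(sorted _ (0 :: _)) cons_grid_partition.
  apply: (homo_sorted (e := ltn)) (iota_ltn_sorted _ _) => i j ij.
  exact: grid_lt.
rewrite /grid_partition -{1}(grid0 0 L n) last_map; apply/eqP.
rewrite (last_nth 0%N) size_iota -[_ :: _]/(iota 0 n.+1) nth_iota//.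
by rewrite add0n gridn.
Qed.

Lemma ex_grid_close (L s : R) n : s \in `[0, L] ->
  exists2 j, (j <= n)%N & `|grid 0 L n.+1 j - s| <= L / n.+1%:R.
Proof.
rewrite in_itv/= => /andP[s0 sL].
have [L0|L0] := leP L 0.
  have -> : L = 0 by lra.
  have -> : s = 0 by lra.
  by exists 0; rewrite // grid0 mul0r subrr normr0.
set H := L / _.
have gE j : grid 0 L n.+1 j = H * j%:R by rewrite /grid subr0 add0r.
have H0 : 0 < H by rewrite divr_gt0.
have /andP[ler ltr] := truncn_itv (divr_ge0 s0 (ltW H0)).
rewrite ler_pdivlMr// in ler; rewrite ltr_pdivrMr// -natr1 in ltr.
set j := Num.truncn _ in ler ltr.
have [jn|nj] := leqP j n.
  by exists j => //; rewrite gE ler_norml; apply/andP; split; lra.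
exists n => //.
have LE : L = H * n%:R + H by rewrite -{2}(mulr1 H) -mulrDr natr1 /H divfK// pnatr_eq0.
have : n.+1%:R * H <= j%:R * H by rewrite ler_wpM2r ?ler_nat// ltW.
by rewrite -natr1 gE ler_norml => ?; apply/andP; split; lra.
Qed.

End GridPartition.

Section FineGrids.
Variables (R : realType) (L : R) (c c1 c2 : R -> 'rV[R]_3).
Hypothesis L0 : 0 < L.
Hypothesis dc : derivative_on 0 L c c1.
Hypothesis dc1 : derivative_on 0 L c1 c2.
Hypothesis c2_cont : {within `[0, L], continuous c2}.
Hypothesis unit_speed : forall s, s \in `[0, L] -> enorm (c1 s) = 1.

Let k s := \int[lebesgue_measure]_(x in `[0, s]) enorm (c2 x).
Let L0' : 0 <= L := ltW L0.

Definition grid_chord n i := c (grid 0 L n i.+1) - c (grid 0 L n i).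

Lemma inscribed_grid n :
  inscribed c 0 (grid_partition L n) = [seq c (grid 0 L n i) | i <- iota 0 n.+1].
Proof. by rewrite /inscribed cons_grid_partition -map_comp. Qed.

Lemma segments_grid n : (forall i, (i < n)%N -> grid_chord n i != 0) ->
  segments (inscribed c 0 (grid_partition L n)) = [seq grid_chord n i | i <- iota 0 n].
Proof.
move=> nz; rewrite /segments inscribed_grid differences_map.
apply/all_filterP/allP => _ /mapP[i + ->]; rewrite mem_iota/= add0n => ni.
exact: nz.
Qed.

Definition grid_tangent n i := (enorm (grid_chord n i))^-1 *: grid_chord n i.

Section Estimates.
Variables (K : R) (n : nat).
Hypothesis K0 : 0 <= K.
Hypothesis Kbnd : forall x, x \in `[0, L] -> enorm (c2 x) <= K.
Hypothesis n0 : (0 < n)%N.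
Let h := L / n%:R.
Hypothesis Kh : K * h <= 2^-1.

Let x i := grid 0 L n i.

Let h_gt0 : 0 < h. Proof. by rewrite divr_gt0// ltr0n. Qed.
Let xS i : x i.+1 - x i = h. Proof. by rewrite gridS subr0. Qed.
Let x_ge0 i : 0 <= x i. Proof. by rewrite -(grid0 0 L n) grid_le. Qed.
Let x_mon i : x i <= x i.+1. Proof. by rewrite grid_le. Qed.
Let x_in i : (i <= n)%N -> x i \in `[0, L].
Proof. by move=> ni; apply: grid_in. Qed.
Let x_le i : (i <= n)%N -> x i <= L.
Proof. by move=> /x_in; rewrite in_itv/= => /andP[]. Qed.

Let chord_close i : (i < n)%N -> enorm (h *: c1 (x i) - grid_chord n i) <= K * h * h.
Proof.
move=> ni; rewrite enormBC -(xS i).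
by apply: (chord_approx dc dc1 Kbnd) => //; exact: x_le.
Qed.

Lemma grid_chord_gt i : (i < n)%N -> h / 2 <= enorm (grid_chord n i).
Proof.
move=> ni; have := chord_close ni.
have := enorm_dist_norm (h *: c1 (x i)) (grid_chord n i).
rewrite enormZ unit_speed ?x_in 1?ltnW// mulr1 (gtr0_norm h_gt0).
rewrite ler_norml => /andP[_ h1 h2].
have : K * h * h <= 2^-1 * h by rewrite ler_pM2r.
by lra.
Qed.

Lemma grid_chord_neq0 i : (i < n)%N -> grid_chord n i != 0.
Proof. by move=> /grid_chord_gt; rewrite -enorm_gt0; have := h_gt0; lra. Qed.

Lemma tangents_grid : tangents false (inscribed c 0 (grid_partition L n)) =
  [seq grid_tangent n i | i <- iota 0 n].
Proof. by rewrite /tangents segments_grid -?map_comp//; exact: grid_chord_neq0. Qed.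

Lemma grid_tangent1 i : (i < n)%N -> enorm (grid_tangent n i) = 1.
Proof. by move=> /grid_chord_neq0; exact: enorm_normalize. Qed.

Lemma grid_tangent_close i : (i < n)%N ->
  enorm (c1 (x i) - grid_tangent n i) <= 4 * K * h.
Proof.
move=> ni; have w0 := grid_chord_neq0 ni.
have c11 : enorm (c1 (x i)) = 1 by rewrite unit_speed// x_in// ltnW.
apply: le_trans (normalize_close c11 (ltW h_gt0) w0 (chord_close ni)) _.
rewrite ler_pdivrMr ?enorm_gt0//.
have -> : 2 * (K * h * h) = 4 * K * h * (h / 2) by lra.
by rewrite ler_wpM2l ?grid_chord_gt// !mulr_ge0// ltW.
Qed.

Let T := tangents false (inscribed c 0 (grid_partition L n)).

Lemma nth_tangents_grid i : (i < n)%N -> T`_i = grid_tangent n i.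
Proof. by move=> ni; rewrite /T tangents_grid (nth_map 0%N) ?size_iota// nth_iota. Qed.

Lemma size_tangents_grid : size T = n.
Proof. by rewrite /T tangents_grid size_map size_iota. Qed.

Lemma cumulative_grid_le i : (i < n)%N -> cumulative T i <= k (x i.+1).
Proof.
move=> ni.
(* Strengthened for induction: the path is continued up to the hodograph. *)
suff : cumulative T i + dS2 T`_i (c1 (x i.+1)) <= k (x i.+1).
  apply: le_trans; rewrite lerDl dS2_ge0//; first by rewrite nth_tangents_grid// grid_tangent1.
  by rewrite unit_speed// x_in.
have chord j : (j < n)%N ->
    dS2 (c1 (x j)) T`_j + dS2 T`_j (c1 (x j.+1)) <= k (x j.+1) - k (x j).
  move=> nj; rewrite nth_tangents_grid//.
  exact: (dS2_chord_le L0' dc dc1 c2_cont unit_speed (x_ge0 j) (x_mon j)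
    (x_le nj) (grid_chord_neq0 nj)).
elim: i ni => [|i IH] ni.
  have := chord 0 ni; rewrite cumulative0 /x grid0 -/(x 1%N).
  rewrite /k -/(k (x 1%N)) integral_segment0 nth_tangents_grid//.
  have := dS2_ge0 (unit_speed _) (grid_tangent1 ni) (x := c1 0).
  by rewrite in_itv/= lexx L0' => /(_ isT); lra.
have := IH (ltnW ni); have := chord _ ni; rewrite cumulativeS.
have := dS2_triangle (y := c1 (x i.+1))
  (grid_tangent1 (ltnW ni)) (unit_speed _) (grid_tangent1 ni).
rewrite -!nth_tangents_grid// 1?ltnW// x_in 1?ltnW// => /(_ isT).
by lra.
Qed.

Lemma cumulative_grid_increment i j : (i <= j)%N -> (j < n)%N ->
  enorm (c1 (x j) - c1 (x i)) - 8 * K * h <= cumulative T j - cumulative T i.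
Proof.
move=> ij nj; have ni := leq_ltn_trans ij nj.
suff : enorm (T`_j - T`_i) <= cumulative T j - cumulative T i.
  have := grid_tangent_close ni; have := grid_tangent_close nj.
  rewrite -!nth_tangents_grid//.
  have := enorm_dist T`_j (c1 (x j)) (c1 (x i)).
  have := enorm_dist T`_i (T`_j) (c1 (x i)).
  by rewrite (enormBC T`_i (c1 _)); lra.
elim: j ij nj => [|j IH].
  by rewrite leqn0 => /eqP -> _; rewrite !subrr enorm0.
rewrite leq_eqVlt => /predU1P[-> _|ij nj]; first by rewrite !subrr enorm0.
have := IH ij (ltnW nj); rewrite cumulativeS.
have := chord_le_dS2 (grid_tangent1 (ltnW nj)) (grid_tangent1 nj).
rewrite enormBC -!nth_tangents_grid// 1?ltnW//.
have := enorm_dist T`_j T`_j.+1 T`_i.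
by lra.
Qed.

End Estimates.

Lemma integral_lipschitz K a b : (forall x, x \in `[0, L] -> enorm (c2 x) <= K) ->
  a \in `[0, L] -> b \in `[0, L] -> `|k a - k b| <= K * `|a - b|.
Proof.
move=> Kbnd; wlog ba : a b / b <= a => [wl aL bL|].
  have [|/ltW] := leP b a; first by move=> ba; exact: wl.
  by move=> ab; rewrite distrC (distrC a); exact: wl.
rewrite !in_itv/= => /andP[a0 aL] /andP[b0 bL].
rewrite !ger0_norm ?subr_ge0 ?(integral_nondecreasing c2_cont)//.
apply: (integral_le (continuous_enorm_on c2_cont)) => // x.
rewrite in_itv/= => /andP[bx xa]; apply: Kbnd; rewrite in_itv/=.
by rewrite (le_trans b0 bx) (le_trans xa aL).
Qed.

(** With [m ^ 2] pieces, the tangents at the ends of [m] blocks of [m] pieces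
    are off by [O(1 / m ^ 2)] each, hence their increments by [O(1 / m)] in
    total: up to such an error, the length of the indicatrix is bounded below by
    that of a polygonal with [m] vertices on the hodograph.  The upper bound is
    [cumulative_grid_le]. *)
Lemma grid_indicatrix_approx e : 0 < e ->
  exists m0, forall m, (m0 <= m)%N ->
  let T := tangents false (inscribed c 0 (grid_partition L (m.+1 * m.+1))) in
  forall s, s \in `[0, L] ->
  exists i, [/\ (i < size T)%N, `|cumulative T i - k s| <= e
              & enorm (T`_i - c1 s) <= e].
Proof.
move=> e0; have [K K0 Kbnd] := derivative_bounded c2_cont L0'.
(* Up to a point at distance at most L from 0, replacing arcs of hodograph by
   chords costs at most e' * L = e / 2. *)
pose e' := e / (2 * L).
have [|d d0 dP] := increment_vs_integral dc1 c2_cont (e := e').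
  by rewrite divr_gt0// mulr_gt0.
(* The bound 10 K H <= eta covers the other errors: 8 K H for the tangents at the
   ends of the blocks and at most 2 K H for the distance from s to the nearest
   block; with eta <= 1 / 2, it also ensures that no chord is null. *)
pose eta := Num.min 2^-1 (e / 2).
have eta0 : 0 < eta by rewrite lt_min invr_gt0 ltr0n divr_gt0.
have [eta1 etae] : eta <= 2^-1 /\ eta <= e / 2 by rewrite !ge_min !lexx orbT.
have K10 : 0 < 10 * K + 1 by rewrite ltr_wpDl// mulr_ge0.
have [|m0 m0P] := @ex_step_le R 0 L (Num.min d (eta / (10 * K + 1))).
  by rewrite lt_min d0 divr_gt0.
exists m0 => m /m0P; rewrite subr0; set H := L / _.
have H0 : 0 < H by rewrite divr_gt0.
rewrite le_min ler_pdivlMr// => /andP[Hd Heta].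
have KH : 10 * (K * H) <= eta by lra.
set N := (m.+1 * m.+1)%N => T s sL.
have N0 : (0 < N)%N by [].
pose h := L / N%:R.
have mh : m.+1%:R * h = H by rewrite /h /N natrM /H; field; rewrite nat1r pnatr_eq0.
have hH : h <= H.
  by rewrite -mh ler_peMl// ?divr_ge0// ler1n.
have h0 : 0 < h by rewrite divr_gt0// ltr0n.
have Khh : K * h <= K * H by rewrite ler_wpM2l.
have Kh2 : K * h <= 2^-1 by have := mulr_ge0 K0 (ltW H0); lra.
have sizeT : size T = N by exact: (size_tangents_grid K0 Kbnd N0 Kh2).
pose y j := grid 0 L m.+1 j.
have yE j : grid 0 L N (m.+1 * j) = y j.
  rewrite /y /grid /N !natrM; field; by rewrite nat1r pnatr_eq0.
have blk j : (j <= m)%N -> (m.+1 * j < N)%N by move=> jm; rewrite ltn_pmul2l.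
have yS j : y j.+1 - y j = H by rewrite gridS subr0.
have y_ge0 j : 0 <= y j by rewrite -(grid0 0 L m.+1) grid_le.
have y_in j : (j <= m.+1)%N -> y j \in `[0, L] by move=> jm; apply: grid_in.
have low j : (j <= m)%N ->
    k (y j) - e' * y j - j%:R * (8 * (K * h)) <= cumulative T (m.+1 * j).
  elim: j => [_|j IH jm].
    rewrite muln0 cumulative0 /y grid0 !mulr0 !mul0r !subr0.
    by rewrite /k integral_segment0.
  have {IH} := IH (ltnW jm).
  have jj : (m.+1 * j <= m.+1 * j.+1)%N by rewrite leq_mul2l leqnSn orbT.
  have := cumulative_grid_increment K0 Kbnd N0 Kh2 jj (blk _ jm).
  rewrite !yE -/h -/T.
  have /[!in_itv]/= /andP[_ yL] := y_in _ (leqW jm).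
  have yy : y j <= y j.+1 by rewrite grid_le.
  have := dP _ _ (y_ge0 j) yy yL; rewrite yS => /(_ Hd).
  rewrite ler_norml -(yS j) -!/(k _) => /andP[h1 _] h2 h3.
  by rewrite -natr1; lra.
have [j jm js] := ex_grid_close m sL.
exists (m.+1 * j)%N; split; first by rewrite sizeT blk.
- have up := cumulative_grid_le K0 Kbnd N0 Kh2 (blk _ jm).
  have xin : grid 0 L N (m.+1 * j).+1 \in `[0, L] by apply: grid_in => //; exact: blk.
  have yin : y j \in `[0, L] by rewrite y_in// leqW.
  have := integral_lipschitz Kbnd xin yin.
  rewrite -yE gridS subr0 -/h (gtr0_norm h0) yE.
  have := integral_lipschitz Kbnd yin sL.
  have : K * `|y j - s| <= K * H by rewrite ler_wpM2l.
  have := low _ jm; move: up; rewrite -/T.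
  have : j%:R * (8 * (K * h)) <= 8 * (K * H).
    rewrite -mh [leRHS](_ : _ = m.+1%:R * (8 * (K * h))); last by ring.
    by rewrite ler_wpM2r ?mulr_ge0 ?(ltW h0)// ler_nat leqW.
  have : e' * y j <= e / 2.
    rewrite /e' mulrAC ler_pdivrMr ?mulr_gt0//.
    by move: yin; rewrite in_itv/= => /andP[_ yL]; nra.
  rewrite !ler_norml; move=> h1 h2 h3 h4 h5 /andP[h6 h7] /andP[h8 h9].
  by apply/andP; split; lra.
- have := grid_tangent_close K0 Kbnd N0 Kh2 (blk _ jm).
  rewrite yE -/h.
  have -> : grid_tangent N (m.+1 * j) = T`_(m.+1 * j).
    by rewrite (nth_tangents_grid K0 Kbnd N0 Kh2 (blk _ jm)).
  have yin : y j \in `[0, L] by rewrite y_in// leqW.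
  have := lipschitz_of_derivative dc1 Kbnd yin sL.
  have : K * `|y j - s| <= K * H by rewrite ler_wpM2l.
  have := enorm_dist (c1 (y j)) T`_(m.+1 * j) (c1 s).
  rewrite (enormBC T`_ _ (c1 (y j))).
  have := mulr_ge0 K0 (ltW H0).
  by lra.
Qed.

End FineGrids.

(** * Existence of tangent indicatrices *)

Section GreatCircles.
Variable R : realType.
Implicit Types x y n : 'rV[R]_3.

Lemma ex_orthogonal x : exists2 n, enorm n = 1 & dot x n = 0.
Proof.
suff [w w0 xw] : exists2 w, w != 0 & dot x w = 0.
  by exists ((enorm w)^-1 *: w); rewrite ?enorm_normalize// dotZr xw mulr0.
have dotE3 a b d : dot x (\row_(j < 3) [:: a; b; d]`_j) =
    x 0 0 * a + x 0 1 * b + x 0 2%:R * d.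
  rewrite /dot !big_ord_recl big_ord0 !mxE /= addr0 addrA.
  by congr (_ + _ + _); congr (x 0 _ * _); apply: val_inj.
have [x0|x0] := eqVneq (x 0 0) 0.
  exists (\row_(j < 3) [:: 1; 0; 0]`_j); last by rewrite dotE3 x0; ring.
  by apply/eqP => /matrixP/(_ 0 0)/eqP; rewrite !mxE/= oner_eq0.
exists (\row_(j < 3) [:: - x 0 1; x 0 0; 0]`_j); last by rewrite dotE3; ring.
by apply/eqP => /matrixP/(_ 0 1)/eqP; rewrite !mxE/= (negPf x0).
Qed.

(** For antipodal points any direction orthogonal to [x] starts a minimal
    geodesic. *)
Lemma ex_direction x y : enorm x = 1 -> enorm y = 1 ->
  exists n, [/\ enorm n = 1, dot x n = 0
              & y = cos (dS2 x y) *: x + sin (dS2 x y) *: n].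
Proof.
move=> x1 y1; have := enorm_perp y1 x1; rewrite (dS2C y) (dotC y) -cos_dS2//.
set z := y - _ => zE.
have yE : y = cos (dS2 x y) *: x + z by rewrite addrC subrK.
have [s0|s0] := eqVneq (sin (dS2 x y)) 0.
  have [n n1 xn] := ex_orthogonal x; exists n; split=> //.
  by rewrite {1}yE s0 scale0r; congr (_ + _); apply/eqP; rewrite -enorm_eq0 zE s0.
exists ((sin (dS2 x y))^-1 *: z); split.
- by rewrite -zE enorm_normalize// -enorm_eq0 zE.
- by rewrite dotZr /z !dotE dot_unit// cos_dS2// mulr1 subrr mulr0.
- by rewrite scalerA mulfV// scale1r.
Qed.

Lemma ex_geodesic x y : enorm x = 1 -> enorm y = 1 ->
  exists g : R -> 'rV[R]_3, [/\ g 0 = x, g (dS2 x y) = y, forall u, enorm (g u) = 1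
    & forall u w, `|u - w| <= pi -> dS2 (g u) (g w) = `|u - w|].
Proof.
move=> x1 y1; have [n [n1 xn yE]] := ex_direction x1 y1.
pose g u := cos u *: x + sin u *: n.
have dotg u w : dot (g u) (g w) = cos (u - w).
  by rewrite /g !dotE (dotC n x) xn !dot_unit// cosB; ring.
exists g; split.
- by rewrite /g cos0 sin0 scale1r scale0r addr0.
- exact: esym.
- by move=> u; rewrite /enorm dotg subrr cos0 sqrtr1.
- move=> u w uw; rewrite /dS2 dotg (_ : cos (u - w) = cos `|u - w|).
    by rewrite cosK// in_itv/= uw normr_ge0.
  by have [_|_] := ger0P (u - w); rewrite ?cosN.
Qed.

End GreatCircles.

Section IndicatrixExists.
Variable R : realType.
Implicit Types (x : 'rV[R]_3) (t s : seq 'rV[R]_3).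

(** The defining property of a tangent indicatrix, in terms of the sequence of
    tangents alone: sequences of tangents can be shortened in an induction. *)
Definition spherical_polygonal t (tau : R -> 'rV[R]_3) :=
  (forall i, (i < size t)%N -> tau (cumulative t i) = t`_i) /\
  (forall i, (i.+1 < size t)%N ->
     forall u w, u \in `[cumulative t i, cumulative t i.+1] ->
                 w \in `[cumulative t i, cumulative t i.+1] ->
     sphere2 (tau u) /\ dS2 (tau u) (tau w) = `|u - w|).

Lemma ex_spherical_polygonal t : on_sphere t -> exists tau, spherical_polygonal t tau.
Proof.
case: t => [|x s]; first by exists (fun=> 0); split.
elim: s x => [|y s IH] x t1.
  exists (fun=> x); split=> [[|[]]//|[|[]]//].
have t1' : on_sphere (y :: s) by move=> z zs; apply: t1; rewrite in_cons zs orbT.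
have x1 := t1 x (mem_head _ _); have y1 := t1' y (mem_head _ _).
have [tau' [tau'_vertex tau'_arc]] := IH y t1'.
have [g [g0 gy g1 g_iso]] := ex_geodesic x1 y1.
pose d := dS2 x y; have d0 : 0 <= d by exact: dS2_ge0.
(* The two definitions agree at u = d, even when d = 0. *)
pose tau u := if u <= d then g u else tau' (u - d).
have tauE u : d <= u -> tau u = tau' (u - d).
  rewrite /tau le_eqVlt => /predU1P[<-|du]; last by rewrite leNgt du.
  by rewrite lexx gy subrr -[in RHS](cumulative0 (y :: s)) tau'_vertex.
have cumE i : cumulative [:: x, y & s] i.+1 = d + cumulative (y :: s) i.
  by rewrite cumulative_cons.
have cum_ge0 i : (i < size (y :: s))%N -> 0 <= cumulative (y :: s) i.
  exact: cumulative_ge0.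
exists tau; split=> [[_|i ilt]|[_|i ilt]].
- by rewrite cumulative0 /tau d0.
- by rewrite cumE tauE ?lerDl ?cum_ge0// addrC addKr tau'_vertex.
- rewrite cumE !cumulative0 addr0 => u w; rewrite !in_itv/= => /andP[u0 ud] /andP[w0 wd].
  rewrite /tau ud wd; split; first exact: g1.
  apply: g_iso; have := dS2_le_pi x1 y1; rewrite -/d ler_norml => dpi.
  by apply/andP; split; lra.
- rewrite !cumE => u w; rewrite !in_itv/= => /andP[ul ur] /andP[wl wr].
  have c0 := cum_ge0 i (ltnW ilt).
  rewrite !tauE; [|lra|lra].
  have := tau'_arc i ilt (u - d) (w - d).
  rewrite !in_itv/= => /(_ _ _)/wrap[||].
  + by apply/andP; split; lra.
  + by apply/andP; split; lra.
  by rewrite (_ : u - d - (w - d) = u - w)//; ring.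
Qed.

End IndicatrixExists.

(** * Total curvature and the weak tangent indicatrix *)

Section TotalCurvature.
Variable R : realType.
Implicit Types c : R -> 'rV[R]_3.

Lemma derivative_on_sub (a b s : R) c c1 : s <= b ->
  derivative_on a b c c1 -> derivative_on a s c c1.
Proof.
move=> sb dc x; rewrite in_itv/= => /andP[ax xs].
apply: cvg_trans (dc x _); last by rewrite in_itv/= ax (le_trans xs).
apply: cvg_app; apply: within_subset => u /=.
by rewrite !in_itv/= => /andP[-> /le_trans->].
Qed.

Section Curve.
Variables (L : R) (c c1 c2 : R -> 'rV[R]_3).
Hypothesis L0 : 0 < L.
Hypothesis dc : derivative_on 0 L c c1.
Hypothesis dc1 : derivative_on 0 L c1 c2.
Hypothesis c2_cont : {within `[0, L], continuous c2}.
Hypothesis unit_speed : forall s, s \in `[0, L] -> enorm (c1 s) = 1.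

Let k s := \int[lebesgue_measure]_(x in `[0, s]) enorm (c2 x).

Lemma grid_TCpoly_ge e : 0 < e -> exists m0, forall m, (m0 <= m)%N ->
  forall cyc, k L - e <= TCpoly cyc (inscribed c 0 (grid_partition L (m.+1 * m.+1))).
Proof.
move=> /(grid_indicatrix_approx L0 dc dc1 c2_cont unit_speed)[m0 m0P].
exists m0 => m mm cyc; have LL : L \in `[0, L] by rewrite in_itv/= lexx ltW.
have [i [iT + _]] := m0P m mm L LL.
rewrite ler_norml -/(k _) => /andP[close _].
by have := cumulative_le_TCpoly cyc iT; lra.
Qed.

Lemma TC_eq_integral (cyc : bool) : (cyc -> c1 0 = c1 L) -> TC cyc c 0 L = (k L)%:E.
Proof.
move=> closed; apply/eqP; rewrite eq_le; apply/andP; split.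
  apply: ge_ereal_sup => _ [l part <-]; rewrite lee_fin.
  have := TCpoly_le (ltW L0) dc dc1 c2_cont unit_speed part (lexx 0) (lexx L) closed.
  by rewrite integral_segment0 subr0.
apply/lee_addgt0Pr => e e0; have [m0 /(_ _ (leqnn _) cyc)] := grid_TCpoly_ge e0.
rewrite lerBlDr -lee_fin EFinD => /le_trans; apply; rewrite leeD2r//.
apply: ereal_sup_ubound; exists (grid_partition L (m0.+1 * m0.+1)) => //.
exact: grid_partitionP.
Qed.

End Curve.

(** Apply [TC_eq_integral] to the curve restricted to [0, s]; at [s = 0] the only
    partition is empty. *)
Lemma TC_arc_eq_integral (L s : R) c c1 c2 : 0 < L ->
  derivative_on 0 L c c1 -> derivative_on 0 L c1 c2 ->
  {within `[0, L], continuous c2} ->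
  (forall s, s \in `[0, L] -> enorm (c1 s) = 1) -> s \in `[0, L] ->
  TC false c 0 s = (\int[lebesgue_measure]_(x in `[0, s]) enorm (c2 x))%:E.
Proof.
move=> L0 dc dc1 c2_cont unit_speed.
rewrite in_itv/= le_eqVlt => /andP[/predU1P[<- _|s0 sL]].
  rewrite integral_segment0; apply/eqP; rewrite eq_le; apply/andP; split.
    apply: ge_ereal_sup => _ [l /itv_partitionxx -> <-].
    by rewrite /TCpoly /tangents /= cumulative0.
  apply: ereal_sup_ubound; exists [::]; first by split.
  by rewrite /TCpoly /tangents /= cumulative0.
apply: (TC_eq_integral s0 (derivative_on_sub sL dc) (derivative_on_sub sL dc1)) => //.
  by apply: continuous_subspaceW c2_cont; apply: subset_itvl; rewrite bnd_simp.
move=> x; rewrite in_itv/= => /andP[x0 xs].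
by rewrite unit_speed// in_itv/= x0 (le_trans xs).
Qed.

Lemma arclength_lipschitz (C : R) c x y : arclength_param c 0 C ->
  x \in `[0, C] -> y \in `[0, C] -> enorm (c x - c y) <= `|x - y|.
Proof.
move=> arc; wlog yx : x y / y <= x => [wl xC yC|].
  have [|/ltW] := leP y x; first by move=> yx; exact: wl.
  by move=> xy; rewrite enormBC distrC; exact: wl.
rewrite !in_itv/= => /andP[x0 xC] /andP[y0 yC].
move: yx; rewrite le_eqVlt => /predU1P[->|yx]; first by rewrite !subrr enorm0 normr0.
have := enorm_le_curve_length c yx; rewrite arc ?(ltW yx)// lee_fin.
by rewrite gtr0_norm// subr_gt0.
Qed.

Lemma nth_tangents cyc (P : seq 'rV[R]_3) i : (i < size (tangents false P))%N ->
  [/\ (i < size (tangents cyc P))%N, (tangents cyc P)`_i = (tangents false P)`_i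
    & cumulative (tangents cyc P) i = cumulative (tangents false P) i].
Proof.
move=> iT; case: cyc => //; split; last exact: (cumulative_cat _ iT).
  by rewrite size_cat ltn_addr.
by rewrite nth_cat iT.
Qed.

Lemma cvg0_of_le_step (L : R) (u : nat -> R) : 0 <= L ->
  (forall h, 0 <= u h <= L / h.+1%:R) -> u h @[h --> \oo] --> (0 : R).
Proof.
move=> L0 ule; apply/cvgrPdist_le => e e0.
have [n nP] := ex_step_le 0 L e0.
exists n => // h /= /nP; rewrite subr0 sub0r normrN => step.
by have /andP[u0 uh] := ule h; rewrite ger0_norm// (le_trans uh).
Qed.

Section WeakIndicatrix.
Variables (L : R) (c c1 c2 tc : R -> 'rV[R]_3) (cyc : bool).
Hypothesis L0 : 0 < L.
Hypothesis dc : derivative_on 0 L c c1.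
Hypothesis dc1 : derivative_on 0 L c1 c2.
Hypothesis c2_cont : {within `[0, L], continuous c2}.
Hypothesis unit_speed : forall s, s \in `[0, L] -> enorm (c1 s) = 1.
Hypothesis closed : cyc -> c1 0 = c1 L.
Hypothesis tc_weak : weak_tangent_indicatrix cyc c L tc.

Let k s := \int[lebesgue_measure]_(x in `[0, s]) enorm (c2 x).
Let P m := inscribed c 0 (grid_partition L (m.+1 * m.+1)).

Let step_le m : L / (m.+1 * m.+1)%:R <= L / m.+1%:R.
Proof.
by rewrite ler_wpM2l ?(ltW L0)// lef_pV2 ?posrE ?ltr0n// ler_nat leq_pmulr.
Qed.

Let mesh_le m : 0 <= mesh (P m) <= L / m.+1%:R.
Proof.
apply/andP; split; first by rewrite /mesh; exact: bigmax_ge_id.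
apply: le_trans (step_le m); rewrite /mesh big_seq.
apply: bigmax_le => [|w]; first by rewrite divr_ge0 ?(ltW L0).
rewrite mem_filter => /andP[_].
rewrite /P inscribed_grid differences_map => /mapP[i + ->].
rewrite mem_iota add0n => im.
have speed x : x \in `[0, L] -> enorm (c1 x) <= 1 by move=> /unit_speed ->.
rewrite (le_trans (lipschitz_of_derivative dc speed _ _))//.
- by apply: grid_in; rewrite ?(ltW L0).
- by apply: grid_in; rewrite ?(ltW L0)// ltnW.
- by rewrite mul1r gridS subr0 ger0_norm// divr_ge0// ltW.
Qed.

Let partition_mesh_le m :
  0 <= partition_mesh 0 (grid_partition L (m.+1 * m.+1)) <= L / m.+1%:R.
Proof.
apply/andP; split; first by rewrite /partition_mesh; exact: bigmax_ge_id.
apply: le_trans (step_le m); rewrite /partition_mesh big_seq.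
apply: bigmax_le => [|w]; first by rewrite divr_ge0 ?(ltW L0).
rewrite cons_grid_partition differences_map => /mapP[i _ ->].
by rewrite gridS subr0.
Qed.

(** The vertex of the indicatrix of a fine polygonal that is close to [c1 s]
    has abscissa close to [k s]; rescaling its parameter to [0, k L] moves it by
    at most the defect of the total curvature of the polygonal. *)
Lemma weak_indicatrix_at s : s \in `[0, L] -> c1 s = tc (k s).
Proof.
move=> sL; have [_ tc_arc tc_lim] := tc_weak.
rewrite (TC_eq_integral L0 dc dc1 c2_cont unit_speed closed)/= -/(k L) in tc_arc tc_lim.
have indicatrix h : exists tau, tangent_indicatrix cyc (P h) tau.
  exact/ex_spherical_polygonal/tangents_on_sphere.
have [tau tauP] := boolp.choice indicatrix.
have kL : k s \in `[0, k L].
  move: sL; rewrite !in_itv/= => /andP[s0 sL].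
  have := integral_nondecreasing c2_cont s0 sL (lexx _).
  have := integral_nondecreasing c2_cont (lexx 0) s0 sL.
  by rewrite integral_segment0 -!/(k _) => -> ->.
have {}tc_lim := tc_lim (fun h => grid_partition L (h.+1 * h.+1)) tau
  (fun h => grid_partitionP L0 (ltn0Sn _)) tauP (cvg0_of_le_step (ltW L0) mesh_le)
  (cvg0_of_le_step (ltW L0) partition_mesh_le).
suff bound e : 0 < e -> enorm (c1 s - tc (k s)) <= 5 * e.
  apply/eqP; rewrite -subr_eq0 -enorm_eq0 eq_le enorm_ge0 andbT.
  apply/ler_addgt0Pl => e e0; rewrite addr0.
  by have := bound (e / 5); rewrite divr_gt0// => /(_ isT); lra.
move=> e0.
have [m1 m1P] := grid_indicatrix_approx L0 dc dc1 c2_cont unit_speed e0.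
have [m2 m2P] := grid_TCpoly_ge L0 dc dc1 c2_cont unit_speed e0.
have [m3 _ m3P] : \forall h \near \oo, forall u, u \in `[0, k L] ->
    enorm (tc u - tau h (TCpoly cyc (P h) * u / k L)) <= 2 * e.
  have tc_nbhs : nbhs (tc : {uniform` `[0, k L] -> 'rV[R]_3})
      [set f | forall u, u \in `[0, k L] -> ball (tc u) e (f u)].
    apply/uniform_nbhs; exists [set p | ball p.1 e p.2].
    by split=> //; exact: (@entourage_ball _ _ (PosNum e0)).
  have := tc_lim _ tc_nbhs; rewrite /nbhs/=; apply: filterS => h /= hP u uin.
  rewrite (le_trans (enorm_le_norm _))// ler_pM2l//.
  by have := hP u uin; rewrite mx_norm_ball => /ltW.
pose m := maxn m1 (maxn m2 m3).
have [m1m m2m m3m] : [/\ (m1 <= m)%N, (m2 <= m)%N & (m3 <= m)%N].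
  by rewrite /m !leq_max !leqnn !orbT.
have [i [iT cum_close t_close]] := m1P m m1m s sL.
have TC_close := m2P m m2m cyc.
have TC_le := TCpoly_le (ltW L0) dc dc1 c2_cont unit_speed
  (grid_partitionP L0 (ltn0Sn _)) (lexx 0) (lexx L) closed
  (l := grid_partition L (m.+1 * m.+1)).
rewrite integral_segment0 subr0 -/(P m) -/(k L) in TC_le.
rewrite -/(P m) -/(k s) -/(k L) in iT cum_close t_close TC_close.
have cum_le := cumulative_le_TCpoly cyc iT.
have cum_ge := cumulative_ge0 (tangents_on_sphere (P := P m)) iT.
have [iTc tE cE] := nth_tangents cyc iT.
have := (tauP m).1 i iTc; rewrite tE cE.
move: cum_le cum_ge cum_close t_close.
set cum := cumulative _ _; set t := nth _ _ _; set tcp := TCpoly _ _ in TC_le TC_close *.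
move=> cum_le cum_ge cum_close t_close tau_cum.
have tcp_ge0 : 0 <= tcp by exact: TCpoly_ge0.
(* If tcp = 0 then cum = 0, and the value u = 0 is still the right one. *)
pose u := k L * cum / tcp.
have uE : tcp * u / k L = cum.
  have [tcp0|tcp0] := eqVneq tcp 0.
    by rewrite tcp0 !mul0r; apply/eqP; rewrite eq_le cum_ge -tcp0 cum_le.
  have k0 : k L != 0.
    by rewrite gt_eqF// (lt_le_trans _ TC_le)// lt_def tcp0.
  by rewrite /u; field; rewrite tcp0 k0.
have [u_in u_cum] : u \in `[0, k L] /\ `|u - cum| <= e.
  have [tcp0|tcp0] := eqVneq tcp 0.
    have cum0 : cum = 0 by apply/eqP; rewrite eq_le cum_ge -tcp0 cum_le.
    rewrite /u tcp0 cum0 invr0 mulr0 subrr normr0; split; last exact: ltW.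
    by rewrite in_itv/= lexx (le_trans tcp_ge0).
  have tcp_gt0 : 0 < tcp by rewrite lt_def tcp0.
  have u_ge : cum <= u by rewrite /u ler_pdivlMr// mulrC ler_wpM2r.
  have u_le : u <= k L.
    by rewrite /u ler_pdivrMr// ler_wpM2l// (le_trans tcp_ge0).
  rewrite in_itv/= u_le (le_trans cum_ge)//=; split=> //.
  rewrite ger0_norm ?subr_ge0//.
  apply: (@le_trans _ _ (k L - tcp)); last by lra.
  have -> : u - cum = (k L - tcp) * cum / tcp by rewrite /u; field.
  by rewrite ler_pdivrMr// ler_wpM2l// subr_ge0.
have tc_tau := m3P m m3m u u_in.
rewrite uE tau_cum in tc_tau.
have := arclength_lipschitz tc_arc u_in kL.
have := enorm_dist (tc u) t (tc (k s)).
have := enorm_dist t (c1 s) (tc (k s)).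
have : `|u - k s| <= 2 * e.
  have := ler_normD (u - cum) (cum - k s); rewrite subrKA; lra.
rewrite (enormBC (c1 s) t) (enormBC t (tc u)); lra.
Qed.

End WeakIndicatrix.

End TotalCurvature.

Theorem proposition4p7 (R : realType) (cyc : bool) (L : R)
    (c c1 c2 tc : R -> 'rV[R]_3)
    (L_gt0 : 0 < L)
    (c_C2 : class_C2 0 L c c1 c2)
    (c_arclength : arclength_param c 0 L)
    (c_closed : cyc -> closes_up 0 L c c1 c2)
    (tc_weak : weak_tangent_indicatrix cyc c L tc) :
  exists k : R -> R,
    [/\ forall s, s \in `]0, L[ ->
          k s \in `[0, fine (TC cyc c 0 L)] /\ c1 s = tc (k s),
        forall s, s \in `[0, L] -> (k s)%:E = TC false c 0 s,
        (k L)%:E = TC cyc c 0 L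
      & forall s, s \in `[0, L] ->
          (k s)%:E = (\int[lebesgue_measure]_(x in `[0%R, s]) (enorm (c2 x))%:E)%E].
Proof.
have [dc dc1 c2_cont] := c_C2.
have [K _ Kbnd] := derivative_bounded c2_cont (ltW L_gt0).
have unit_speed s : s \in `[0, L] -> enorm (c1 s) = 1.
  apply: (arclength_unit_speed L_gt0 dc c_arclength) => x y xL yL.
  exact: (lipschitz_of_derivative dc1 Kbnd).
have closed : cyc -> c1 0 = c1 L by move=> /c_closed[].
have TCL := TC_eq_integral L_gt0 dc dc1 c2_cont unit_speed closed.
exists (fun s => \int[lebesgue_measure]_(x in `[0, s]) enorm (c2 x)); split.
- move=> s /[dup] /subset_itv_oo_cc sL; rewrite in_itv/= => /andP[s0 sL'].
  split; last exact: (weak_indicatrix_at L_gt0 dc dc1 c2_cont unit_speed closed tc_weak sL).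
  rewrite TCL/= in_itv/= -[X in X <= _ <= _](integral_segment0 (fun x => enorm (c2 x))).
  rewrite (integral_nondecreasing c2_cont (lexx _) (ltW s0) (ltW sL')).
  by rewrite (integral_nondecreasing c2_cont (ltW s0) (ltW sL') (lexx L)).
- by move=> s sL; rewrite (TC_arc_eq_integral L_gt0 dc dc1 c2_cont unit_speed sL).
- by rewrite TCL.
- move=> s sL; exact: (EFin_integral (continuous_enorm_on c2_cont) sL).
Qed.
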